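(* Consider a truncation index $N\in\mathbb N$ such that the non-degeneracy assumption (ND) in the context holds. Then there exists a Hamiltonian structure $(\mathrm{Jet}_1(Q),\omega,\mathcal H)$ such that Hamilton's equations recover the reduced equation $$\ddot\phi=a_0(\phi,\dot\phi)+\sum_{i=1}^N h^i\tilde a_i(\phi,\dot\phi)$$ up to $\mathcal O(h^{N+1})$ terms. The symplectic structure $\omega$ and the Hamiltonian $\mathcal H$ can be chosen to be $\mathcal O(h)$-close to $\omega^0$ and $\mathcal H^0$, respectively.
   Context: Everything is local and formal in $h$ (near $h=0$); maps are sufficiently regular. $Q$ is an $n$-dimensional manifold locally identified with an open subset of $\mathbb R^n$; $\phi$ depends on a 1-dimensional variable $\xi$ with values in $Q$. $\mathrm{Jet}_K(Q)$ is the $K$-jet space over $Q$ with coordinates $\{\phi\}_{K\mathrm{jet}}=(\phi,\dot\phi,\phi^{(2)},\dots,\phi^{(K)})$. Consider the Lagrangian given as a formal power series in $h$ $$\mathcal L(\{\phi\}_{\infty\mathrm{jet}})=\mathcal L^0(\phi,\dot\phi)+\sum_{i=1}^\infty h^i\mathcal L^i(\{\phi\}_{M_i\mathrm{jet}})$$ with formal variational principle $\mathcal S(\phi)=\int\mathcal L\,\mathrm d\xi$. Its Euler--Lagrange equations are $\sum_{i\ge0}(-1)^i\frac{\mathrm d^i}{\mathrm d\xi^i}\frac{\partial\mathcal L}{\partial\phi_j^{(i)}}=0$, $j=1,\dots,n$, where $\frac{\mathrm d}{\mathrm d\xi}$ is the total derivative. When $\big(\partial^2\mathcal L^0/\partial\dot\phi_i\partial\dot\phi_j\big)$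 is invertible they are equivalent to a formal power series ODE $\ddot\phi=a_0(\phi,\dot\phi)+\sum_{i\ge1}h^ia_i(\{\phi\}_{m_i\mathrm{jet}})$. Reduced equation: truncating this ODE after order $h^N$ and repeatedly substituting derivatives of order $j\ge2$ on the right-hand side by the expression for $\phi^{(j)}$ given by the $(j-2)$-nd derivative of the truncated ODE, discarding $\mathcal O(h^{N+1})$ terms, yields the second-order equation $\ddot\phi=a_0(\phi,\dot\phi)+\sum_{i=1}^Nh^i\tilde a_i(\phi,\dot\phi)$. (ND): Let $\mathcal L^{[N]}$ be the truncation of $\mathcal L$ after the $h^N$ term and $M=\max\{M_1,\dots,M_N\}$ the order of the highest derivative occurring in $\mathcal L^{[N]}$. The matrices $\big(\partial^2\mathcal L^{[N]}/\partial\phi^{(M)}_i\partial\phi^{(M)}_j\big)_{1\le i,j\le n}$ and $\big(\partial^2\mathcal L^0/\partial\dot\phi_i\partial\dot\phi_j\big)_{1\le i,j\le n}$ are of full rank for all sufficiently small, positive values of the discretisation parameter(s) (here: of $h$). Zeroth-order structure: $\mathfrak q=\phi$, $\mathfrak p=\partial\mathcal L^0/\partial\dot\phi$, $\omega^0=\sum_{i=1}^n\mathrm d\mathfrak q^i\wedge\mathrm d\mathfrak p_i$, $\mathcal H^0=\langle\dot{\mathfrak q},\mathfrak p\rangle_{\mathbb R^n}-\mathcal L^0$, regarded on $\mathrm{Jet}_1(Q)$ with coordinates $(\phi,\dot\phi)$. A Hamiltonian structure is a ($h$-dependent) symplectic form $\omega$ and function $\mathcal H$; Hamilton's equations are $\dot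 z=X(z)$ with $\iota_X\omega=\mathrm d\mathcal H$. ''Recover up to $\mathcal O(h^{N+1})$ terms'' means that $X$ agrees, up to $\mathcal O(h^{N+1})$, with the vector field $(\phi,\dot\phi)\mapsto(\dot\phi,\ a_0+\sum_{i=1}^Nh^i\tilde a_i)$. ''$\mathcal O(h)$-close'' means the difference is $\mathcal O(h)$. *)

(* Defs.v *)
From HB Require Import structures.
From mathcomp Require Import all_boot all_order all_algebra.
From mathcomp Require Import all_classical all_reals all_analysis.

Set Implicit Arguments.
Unset Strict Implicit.
Unset Printing Implicit Defensive.

Import Order.TTheory GRing.Theory Num.Theory.
Import numFieldNormedType.Exports.

Local Open Scope classical_set_scope.
Local Open Scope ring_scope.

(* C^oo on U: every iterated directional derivative is Frechet differentiable
   at every point of U. *)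
Definition smooth_on (R : realType) (V : normedModType R) (U : set V)
    (f : V -> R) : Prop :=
  forall (vs : seq V) (x : V), U x ->
    differentiable (foldr (fun v g => fun y => 'D_v g y) f vs) x.

(* The truncation after h^N of the formal power series \sum_k h^k c_k. *)
Definition hsum (R : realType) (X : Type) (V : lmodType R) (N : nat)
    (c : nat -> X -> V) (h : R) (x : X) : V :=
  \sum_(k < N.+1) h ^+ k *: c k x.

Section Jets.
Variables (R : realType) (n : nat).

(* Points of the infinite jet space in coordinates: J k is phi^(k).  A function
   on a K-jet space is regarded as a function of J through J 0, ..., J K. *)
Definition jet := nat -> 'rV[R]_n.

Definition jet_trunc (K : nat) (J : jet) : 'M[R]_(K.+1, n) :=
  \matrix_(k < K.+1) J k.

(* Jet_1(Q) has the coordinates row_mx phi phidot. *)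
Definition jet_to1 (J : jet) : 'rV[R]_(n + n) := row_mx (J 0%N) (J 1%N).

Definition jet_of1 (z : 'rV[R]_(n + n)) : jet := fun k =>
  match k with 0%N => lsubmx z | 1%N => rsubmx z | _ => 0 end.

Definition Jet1 (Q : set 'rV[R]_n) : set 'rV[R]_(n + n) :=
  [set z | Q (lsubmx z)].

(* partial derivative with respect to the j-th component of phi^(k) *)
Definition jpartial (k : nat) (j : 'I_n) (f : jet -> R) (J : jet) : R :=
  derive1 (fun t : R =>
    f (fun l => if l == k then J l + t *: delta_mx 0 j else J l)) 0.

(* d/dxi = \sum_k phi^(k+1) . d/dphi^(k).  Only finitely many terms are nonzero
   if f is a function on some K-jet space, so the sum over all k makes sense. *)
Definition total_deriv (f : jet -> R) (J : jet) : R :=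
  \sum_(k \in [set: nat]) \sum_(j < n) J k.+1 0 j * jpartial k j f J.

Definition jhessian (k : nat) (f : jet -> R) (J : jet) : 'M[R]_n :=
  \matrix_(i, j) jpartial k i (jpartial k j f) J.

(* L^0 lives on the 1-jet space, L^i on the (M i)-jet space for i >= 1. *)
Definition lag_order (M : nat -> nat) (i : nat) : nat :=
  if i is 0%N then 1%N else M i.

Definition lagrangian (M : nat -> nat) : Type :=
  forall i : nat, 'M[R]_((lag_order M i).+1, n) -> R.

Definition lag_smooth (M : nat -> nat) (Q : set 'rV[R]_n)
    (L : lagrangian M) : Prop :=
  forall i, smooth_on [set x | Q (row ord0 x)] (L i).

Section Lagrangian.
Variables (M : nat -> nat) (L : lagrangian M).

Definition lag (i : nat) (J : jet) : R := L (jet_trunc (lag_order M i) J).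

(* max {1, M_1, ..., M_N}; L^0 always contributes order 1 *)
Definition max_order (N : nat) : nat := \max_(i < N.+1) lag_order M i.

Definition nondegenerate_lag (Q : set 'rV[R]_n) (N : nat) : Prop :=
  forall J : jet, Q (J 0%N) ->
    \forall h \near (0 : R)^'+,
      \rank (jhessian (max_order N) (hsum N lag h) J) = n /\
      \rank (jhessian 1 (lag 0) J) = n.

(* h^i-coefficient of the Euler-Lagrange expressions, j = 1..n *)
Definition euler_lagrange (i : nat) (J : jet) : 'rV[R]_n :=
  \row_j \sum_(m < (lag_order M i).+1)
    (-1) ^+ m * iter m total_deriv (jpartial m j (lag i)) J.

(* Right-hand side a_0 + h a_1 + ... of the Euler-Lagrange equations solved for
   phi^(2).  The Hessian W of L^0 in phidot is the coefficient of - phi^(2) in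
   the h^0-part, which is otherwise a function on the 1-jet space: see
   euler_lagrange0_ode and euler_lagrangeS_ode below. *)
Definition ode_rhs (i : nat) (J : jet) : 'rV[R]_n :=
  euler_lagrange i (if i is 0%N then jet_of1 (jet_to1 J) else J)
    *m invmx (jhessian 1 (lag 0) J).

(* The jet (phi, phidot, A, dA/dxi, d^2A/dxi^2, ...), where phi^(2) = A is the
   equation truncated after h^N. *)
Definition subst_jet (N : nat) (h : R) (J : jet) : jet := fun k =>
  if (k < 2)%N then J k
  else \row_j iter (k - 2) total_deriv (fun J' => hsum N ode_rhs h J' 0 j) J.

(* One round of substitutions in \sum_(i <= N) h^i r_i, expanded in powers
   of h: the result is the family of h^k-coefficients, obtained as Taylor
   coefficients at h = 0.  Only those with k <= N are relevant. *)
Definition substitute (N : nat) (r : nat -> jet -> 'rV[R]_n) :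
    nat -> jet -> 'rV[R]_n := fun k J =>
  \row_j ((k`!%:R)^-1 *
    derive1n k (fun h : R => hsum N r h (subst_jet N h J) 0 j) 0).

(* a i : Jet_1(Q) -> R^n, i <= N, are the coefficients a_0, \tilde a_1, ...,
   \tilde a_N of the equation in which the repeated substitution ends. *)
Definition reduced_coefs (Q : set 'rV[R]_n) (N : nat)
    (a : nat -> 'rV[R]_(n + n) -> 'rV[R]_n) : Prop :=
  exists s : nat, forall (k : nat) (J : jet), (k <= N)%N -> Q (J 0%N) ->
    iter s (substitute N) ode_rhs k J = a k (jet_to1 J).

End Lagrangian.

(* (phi, phidot) |-> (phidot, \sum_(i <= N) h^i a_i(phi, phidot)) *)
Definition second_order_field (N : nat)
    (a : nat -> 'rV[R]_(n + n) -> 'rV[R]_n) (h : R) (z : 'rV[R]_(n + n)) :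
    'rV[R]_(n + n) := row_mx (rsubmx z) (hsum N a h z).

End Jets.

(* Exterior calculus on R^m: covectors are rows, and a 2-form w is given by the
   matrices (w z a b) = w_z(e_a, e_b), so that X *m w z is iota_X w at z. *)
Section Forms.
Variables (R : realType) (m : nat).

Definition differential (f : 'rV[R]_m -> R) (z : 'rV[R]_m) : 'rV[R]_m :=
  \row_a 'D_(delta_mx 0 a) f z.

Definition wedge1 (u v : 'rV[R]_m) : 'M[R]_m :=
  \matrix_(a, b) (u 0 a * v 0 b - u 0 b * v 0 a).

Definition closed_form (U : set 'rV[R]_m) (w : 'rV[R]_m -> 'M[R]_m) : Prop :=
  forall z, U z -> forall a b c : 'I_m,
    differential (fun y => w y b c) z 0 a +
    differential (fun y => w y c a) z 0 b +
    differential (fun y => w y a b) z 0 c = 0.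

Definition two_form (U : set 'rV[R]_m) (w : 'rV[R]_m -> 'M[R]_m) : Prop :=
  (forall a b, smooth_on U (fun z => w z a b)) /\
  (forall z, U z -> (w z)^T = - w z).

(* P h z holds locally in z in U and near h = 0. *)
Definition near_h0 (U : set 'rV[R]_m) (P : R -> 'rV[R]_m -> Prop) : Prop :=
  forall z0, U z0 -> \forall z \near z0 & h \near (0 : R), P h z.

(* f = O(h^d), locally uniformly on U *)
Definition bigO_h (V : normedModType R) (U : set 'rV[R]_m) (d : nat)
    (f : R -> 'rV[R]_m -> V) : Prop :=
  forall z0, U z0 -> exists C : R,
    \forall z \near z0 & h \near (0 : R), `|f h z| <= C * `|h| ^+ d.

End Forms.

Section Hamiltonian.
Variables (R : realType) (n : nat) (M : nat -> nat) (L : lagrangian R n M).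
Local Notation J1 := 'rV[R]_(n + n).

(* q^i = phi_i, p_i = dL^0/dphidot_i *)
Definition coord_q (i : 'I_n) (z : J1) : R := lsubmx z 0 i.
Definition coord_p (i : 'I_n) (z : J1) : R :=
  jpartial 1 i (lag L 0) (jet_of1 z).

Definition omega0 (z : J1) : 'M[R]_(n + n) :=
  \sum_(i < n) wedge1 (differential (coord_q i) z) (differential (coord_p i) z).

Definition hamiltonian0 (z : J1) : R :=
  \sum_(i < n) rsubmx z 0 i * coord_p i z - lag L 0 (jet_of1 z).

End Hamiltonian.

(* An h-dependent Hamiltonian structure on U: w and H are series in h, used
   through their truncations after h^N, which are symplectic locally in U
   for h near 0. *)
Definition hamiltonian_structure (R : realType) (m : nat) (U : set 'rV[R]_m)
    (N : nat) (w : nat -> 'rV[R]_m -> 'M[R]_m) (H : nat -> 'rV[R]_m -> R) :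
    Prop :=
  [/\ forall k, (k <= N)%N -> two_form U (w k),
      forall k, (k <= N)%N -> smooth_on U (H k),
      forall h, closed_form U (hsum N w h) &
      near_h0 U (fun h z => hsum N w h z \in unitmx)].

(* iota_X w = dH *)
Definition hamiltonian_field (R : realType) (m : nat) (U : set 'rV[R]_m)
    (w : R -> 'rV[R]_m -> 'M[R]_m) (H : R -> 'rV[R]_m -> R)
    (X : R -> 'rV[R]_m -> 'rV[R]_m) : Prop :=
  near_h0 U (fun h z => X h z *m w h z = differential (H h) z).

Section SolvedForm.
Variables (R : realType) (n : nat) (M : nat -> nat) (L : lagrangian R n M).

Lemma lag_eq i (J J' : jet R n) :
  (forall k, (k <= lag_order M i)%N -> J k = J' k) -> lag L i J = lag L i J'.
Proof.
move=> JJ'; congr (L _); apply/matrixP => k j; rewrite !mxE JJ' //.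
by rewrite -ltnS.
Qed.

Lemma jpartial_eq K k j (f : jet R n -> R) :
  (forall J J' : jet R n, (forall l, (l <= K)%N -> J l = J' l) -> f J = f J') ->
  forall J J' : jet R n, (forall l, (l <= K)%N -> J l = J' l) ->
  jpartial k j f J = jpartial k j f J'.
Proof.
move=> fK J J' JJ'; congr (derive1 _ _); apply/funext => t; apply: fK => l lK.
by rewrite JJ'.
Qed.

Lemma jpartial_eq0 K k j (f : jet R n -> R) :
  (forall J J' : jet R n, (forall l, (l <= K)%N -> J l = J' l) -> f J = f J') ->
  (K < k)%N -> forall J, jpartial k j f J = 0.
Proof.
move=> fK Kk J; rewrite /jpartial.
rewrite (_ : (fun t : R => _) = cst (f J)) ?derive1_cst//.
apply/funext => t; apply: fK => l lK.
by case: eqP => // lk; move: Kk; rewrite -lk ltnNge lK.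
Qed.

Lemma total_derivE K (f : jet R n -> R) :
  (forall J J' : jet R n, (forall l, (l <= K)%N -> J l = J' l) -> f J = f J') ->
  forall J, total_deriv f J =
    \sum_(k < K.+1) \sum_(j < n) J k.+1 0 j * jpartial k j f J.
Proof.
move=> fK J; rewrite /total_deriv.
rewrite -(big_mkord xpredT
  (fun k => \sum_(j < n) J k.+1 0 j * jpartial k j f J)).
rewrite -(fsbig_widen [set k | k \in index_iota 0 K.+1]) //=.
  by rewrite -fsbig_seq // iota_uniq.
move=> k [_ /=]; rewrite mem_index_iota /= => /negP; rewrite -leqNgt => Kk.
by apply: big1 => j _; rewrite (jpartial_eq0 _ fK)// mulr0.
Qed.

Lemma euler_lagrange0E (J : jet R n) j : euler_lagrange L 0 J 0 j =
  jpartial 0 j (lag L 0) J - total_deriv (jpartial 1 j (lag L 0)) J.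
Proof.
rewrite mxE big_ord_recl big_ord_recl big_ord0 addr0.
by rewrite expr0 mul1r expr1 mulN1r.
Qed.

Lemma euler_lagrange0_ode (J : jet R n) : \rank (jhessian 1 (lag L 0) J) = n ->
  euler_lagrange L 0 J = (ode_rhs L 0 J - J 2%N) *m jhessian 1 (lag L 0) J.
Proof.
move=> rk; rewrite mulmxBl mulmxKV; last by rewrite -row_full_unit /row_full rk.
have : forall l, (l <= 1)%N -> J l = jet_of1 (jet_to1 J) l.
  by case=> [|[|]] // _; rewrite /jet_of1 /jet_to1 (row_mxKl, row_mxKr).
have : jet_of1 (jet_to1 J) 2%N = 0 by [].
move: (jet_of1 (jet_to1 J)) => J1 J12 JJ1.
have L0 : forall K K' : jet R n, (forall l, (l <= 1)%N -> K l = K' l) ->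
  lag L 0 K = lag L 0 K' by move=> K K' KK'; apply: (@lag_eq 0%N).
have pL k j := jpartial_eq k j L0.
have ppL k i j := jpartial_eq k i (pL 1%N j).
apply/rowP => j; rewrite [RHS]mxE [X in _ + X]mxE !euler_lagrange0E.
have Dp (K : jet R n) : total_deriv (jpartial 1 j (lag L 0)) K =
    \sum_(i < n) K 1%N 0 i * jpartial 0 i (jpartial 1 j (lag L 0)) K +
    \sum_(i < n) K 2%N 0 i * jpartial 1 i (jpartial 1 j (lag L 0)) K.
  have sum2 (F : nat -> R) : \sum_(k < 2) F k = F 0%N + F 1%N.
    by rewrite !big_ord_recl big_ord0 addr0.
  rewrite (total_derivE (pL 1%N j)).
  exact: (sum2 (fun k => \sum_(i < n) K k.+1 0 i *
    jpartial k i (jpartial 1 j (lag L 0)) K)).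
have e0 := pL 0%N j _ _ JJ1.
have e1 : \sum_(i < n) J 1%N 0 i * jpartial 0 i (jpartial 1 j (lag L 0)) J =
    \sum_(i < n) J1 1%N 0 i * jpartial 0 i (jpartial 1 j (lag L 0)) J1.
  by apply: eq_bigr => i _; rewrite (ppL 0%N i j _ _ JJ1) JJ1.
have e2 : \sum_(i < n) J1 2%N 0 i * jpartial 1 i (jpartial 1 j (lag L 0)) J1 = 0.
  by apply: big1 => i _; rewrite J12 mxE mul0r.
have e3 : \sum_(i < n) J 2%N 0 i * jpartial 1 i (jpartial 1 j (lag L 0)) J =
    (J 2%N *m jhessian 1 (lag L 0) J) 0 j.
  by rewrite mxE; apply: eq_bigr => i _; rewrite [in RHS]mxE.
have alg (x y z t : R) : x = y -> x - (z + t) = y - (z + 0) - t.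
  by move=> ->; rewrite addr0 opprD addrA.
rewrite (etrans (Dp J) (f_equal2 +%R e1 e3)).
by rewrite (etrans (Dp J1) (f_equal2 +%R erefl e2)); exact: alg.
Qed.

Lemma euler_lagrangeS_ode i (J : jet R n) :
  \rank (jhessian 1 (lag L 0) J) = n ->
  euler_lagrange L i.+1 J = ode_rhs L i.+1 J *m jhessian 1 (lag L 0) J.
Proof.
by move=> rk; rewrite /ode_rhs mulmxKV// -row_full_unit /row_full rk.
Qed.

End SolvedForm.

(* Main.v *)
Require Import Defs.
From HB Require Import structures.
From mathcomp Require Import all_boot all_order all_algebra.
From mathcomp Require Import all_classical all_reals all_analysis.
From mathcomp Require Import ring.
Import Order.TTheory GRing.Theory Num.Theory.
Import numFieldNormedType.Exports.
Local Open Scope classical_set_scope.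
Local Open Scope ring_scope.

(** Let [sigma] be the embedding of the 1-jet space into the infinite jet space
    along the reduced equation [phi'' = A], [A = \sum_(i <= N) h^i a_i], i.e.
    [phi^(k)] is the [(k-2)]-nd derivative of [A] along the flow [X_A] of the
    reduced equation.  The total derivative restricts to [X_A] along [sigma].
    Ostrogradsky's one-form [theta = \sum_k P_k dphi^(k)] and energy
    [E = \sum_k P_k phi^(k+1) - L] satisfy on the infinite jet space
    [iota_(d/dxi) (- dtheta) = dE + EL dphi], where [EL] is the Euler-Lagrange
    expression; pulling this identity back along [sigma] gives
    [iota_(X_A) (- dtheta) = dE + (EL o sigma) dphi] on the 1-jet space.
    Induction on [k <= N + 1], running through the rounds of substitutions, shows
    that [A] solves the unreduced equation modulo [h^k] along [sigma], so
    [EL o sigma] vanishes to order [h^(N+1)].  The truncations of [- dtheta] and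
    [E] after [h^N] form the required Hamiltonian structure; at [h = 0] they are
    [omega^0] and [H^0].

    All functions of [h] and a point [z] are smooth functions on a cylinder
    [cyl U], so that "equal modulo [h^k]" becomes vanishing of the first [k]
    derivatives in [h] at [h = 0] ([hflat]), a property preserved by products,
    compositions and derivatives in [z]. *)

Set Implicit Arguments.
Unset Strict Implicit.
Unset Printing Implicit Defensive.

(** * Smooth functions *)

(** [sigma] follows the flow of the polynomial [A] itself, so the pulled-back identity is exact at
    every h and for each coefficient of the Lagrangian separately; expansions in h enter only
    through the defect [EL o sigma]. That defect is the Hessian of [L^0] applied to the unreduced
    right-hand side minus [A]. Each pass of the induction gains a power of h because the
    h^0-coefficient lives on the 1-jet space: a substitution alters only terms carrying a factor h,
    and alters them by as much as the unreduced equation fails along [sigma]. Closedness survives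
    truncation because the one-form is truncated before it is differentiated. Non-degeneracy is read
    off at h = 0, where the off-diagonal blocks of the matrix are, up to sign and transposition, the
    Hessian of [L^0]; it persists for small h by continuity of the determinant. The inverse matrix
    is then locally bounded, which turns an O(h^(N+1)) defect in Hamilton's equations into an
    O(h^(N+1)) error of the vector field. *)

Section SmoothFunctions.
Variable R : realType.
Implicit Types V W : normedModType R.

(** The difference [k] vanishes near [x], hence is differentiable with derivative 0, and
    [g = f + k]. *)
Lemma near_eq_differentiable V W (f g : V -> W) (x : V) :
  (\forall y \near x, f y = g y) -> differentiable f x -> differentiable g x.
Proof.
move=> fg df.
pose k : V -> W := fun y => g y - f y.
have k0 : k x = 0 by rewrite /k (nbhs_singleton fg) subrr.
have kE : k \o shift x = cst (k x) + (cst 0 : V -> W) +o_ (0 : V) id.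
  apply/eqaddoP => e e0.
  have : \forall y \near (0 : V), f (y + x) = g (y + x).
    by move: fg; rewrite (near_shift 0); apply: filterS => y; rewrite [x - 0]subr0.
  apply: filterS => y /= E.
  by rewrite !fctE /= k0 /k E subrr addr0 subrr normr0 mulr_ge0// ltW.
have dk : differentiable k x.
  have lin0 : continuous (\0 : V -> W) by move=> y; exact: cst_continuous.
  apply/diff_locallyP.
  have -> : 'd k x = (\0 : V -> W) :> (V -> W) by exact: diff_unique.
  by split.
have -> : g = (f + k : V -> W) by apply/funext => y; rewrite !fctE /k addrC subrK.
exact: differentiableD.
Qed.

Lemma open_near_eq V (W : Type) (U : set V) (f g : V -> W) : open U ->
  (forall x, U x -> f x = g x) ->
  forall x, U x -> \forall y \near x, f y = g y.
Proof. by move=> oU fg x Ux; apply: filterS (open_nbhs_nbhs (conj oU Ux)). Qed.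

Lemma derive_ext V W (U : set V) (f g : V -> W) v : open U ->
  (forall x, U x -> f x = g x) ->
  forall x, U x -> 'D_v f x = 'D_v g x.
Proof. by move=> oU fg x Ux; apply: near_eq_derive; exact: open_near_eq Ux. Qed.

Lemma smooth_on_ext V (U : set V) (f g : V -> R) : open U ->
  (forall x, U x -> f x = g x) -> smooth_on U f -> smooth_on U g.
Proof.
move=> oU fg sf vs x Ux.
have E : forall y, U y -> foldr (fun v g y => 'D_v g y) f vs y =
    foldr (fun v g y => 'D_v g y) g vs y.
  by elim: vs => //= v vs IH y Uy; apply: derive_ext Uy.
by apply: near_eq_differentiable (sf vs x Ux); exact: open_near_eq Ux.
Qed.

Lemma smooth_on_differentiable V (U : set V) (f : V -> R) x :
  smooth_on U f -> U x -> differentiable f x.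
Proof. by move=> sf Ux; exact: (sf [::]). Qed.

Lemma smooth_on_derivable V (U : set V) (f : V -> R) x v :
  smooth_on U f -> U x -> derivable f x v.
Proof. by move=> sf Ux; apply/diff_derivable/(smooth_on_differentiable sf). Qed.

Lemma smooth_on_continuous V (U : set V) (f : V -> R) x :
  smooth_on U f -> U x -> {for x, continuous f}.
Proof.
by move=> sf Ux; apply/differentiable_continuous/(smooth_on_differentiable sf).
Qed.

Lemma smooth_on_derive V (U : set V) (f : V -> R) v :
  smooth_on U f -> smooth_on U ('D_v f).
Proof. by move=> sf vs x Ux; have := sf (rcons vs v) x Ux; rewrite foldr_rcons. Qed.

(** Coinduction principle: smoothness follows from a class of differentiable functions stable under
    directional derivatives, with no formula for the iterated derivatives. *)
Lemma smooth_on_coind V (U : set V) (C : (V -> R) -> Prop) : open U ->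
  (forall f, C f -> forall x, U x -> differentiable f x) ->
  (forall f v, C f -> exists2 g, C g & forall x, U x -> 'D_v f x = g x) ->
  forall f, C f -> smooth_on U f.
Proof.
move=> oU Cd CD f Cf vs x Ux.
have [g [Cg fg]] : exists g, C g /\
    forall x, U x -> foldr (fun v g y => 'D_v g y) f vs x = g x.
  elim: vs => [|v vs [g [Cg fg]]] /=; first by exists f.
  have [g' Cg' gg'] := CD g v Cg; exists g'; split => // y Uy.
  by rewrite -gg'//; exact: derive_ext Uy.
apply: near_eq_differentiable (Cd _ Cg x Ux).
by apply: open_near_eq Ux => // y Uy; rewrite fg.
Qed.

Section CombineDiff.
Variables (V W : normedModType R) (I : Type) (r : seq I) (c : I -> V -> R) (e : I -> W).
Variable x : V.
Hypothesis dc : forall i, differentiable (c i) x.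

(** Since [smooth_on] concerns scalar functions only, a vector-valued inner map is written as a
    combination of fixed vectors with scalar coefficients. *)
Lemma is_diff_combine : is_diff x (fun y => \sum_(i <- r) c i y *: e i)
  (fun v => \sum_(i <- r) 'd (c i) x v *: e i).
Proof.
elim: r => [|i s IH].
  under [X in is_diff _ X _]funext do rewrite big_nil.
  by under [X in is_diff _ _ X]funext do rewrite big_nil; exact: is_diff_cst.
under [X in is_diff _ X _]funext do rewrite big_cons.
under [X in is_diff _ _ X]funext do rewrite big_cons.
apply: is_diffD => //; apply: DiffDef; first exact: differentiableZl.
by rewrite diffZl.
Qed.

Lemma derive_combine (f : W -> R) v :
  differentiable f (\sum_(i <- r) c i x *: e i) ->
  'D_v (fun y => f (\sum_(i <- r) c i y *: e i)) x =
  \sum_(i <- r) 'D_v (c i) x * 'D_(e i) f (\sum_(i <- r) c i x *: e i).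
Proof.
move=> df; have dG := is_diff_combine.
have dG1 := @ex_diff _ _ _ _ _ _ _ dG.
rewrite (_ : (fun y => _) = f \o fun y => \sum_(i <- r) c i y *: e i)//.
set G := fun y => _ in dG dG1 *.
have dfG : differentiable (f \o G) x by exact: differentiable_comp.
rewrite (deriveE _ dfG) diff_comp// /comp diff_val linear_sum.
apply: eq_bigr => i _; rewrite linearZ /= (deriveE _ df) (deriveE _ (dc i)).
by [].
Qed.

End CombineDiff.

(** * Closure properties of smooth functions *)

Section SmoothClosure.
Variables (V : normedModType R) (U : set V).
Hypothesis oU : open U.

(** The operations are closed jointly: the derivative of a product, inverse or composition mixes
    several of them. On [U] it is again a term, so [smooth_on_coind] settles all cases at once. *)
Inductive smooth_term : (V -> R) -> Prop :=
| SmoothBase f of smooth_on U f : smooth_term f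
| SmoothCst c : smooth_term (fun=> c)
| SmoothAdd f g of smooth_term f & smooth_term g :
    smooth_term (fun x => f x + g x)
| SmoothMul f g of smooth_term f & smooth_term g :
    smooth_term (fun x => f x * g x)
| SmoothInv f of smooth_term f & (forall x, U x -> f x != 0) :
    smooth_term (fun x => (f x)^-1)
| SmoothComp (W : normedModType R) (U' : set W) (I : finType) (e : I -> W)
    (c : I -> V -> R) (f : W -> R) of
    (forall i, smooth_on U (c i)) & smooth_on U' f &
    (forall x, U x -> U' (\sum_i c i x *: e i)) :
    smooth_term (fun x => f (\sum_i c i x *: e i)).

Lemma smooth_term_sum (I : Type) (r : seq I) (F : I -> V -> R) :
  (forall i, smooth_term (F i)) -> smooth_term (fun x => \sum_(i <- r) F i x).
Proof.
move=> sF; elim: r => [|i r IH].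
  by under [X in smooth_term X]funext do rewrite big_nil; exact: SmoothCst.
by under [X in smooth_term X]funext do rewrite big_cons; exact: SmoothAdd.
Qed.

Lemma smooth_term_differentiable f x : smooth_term f -> U x -> differentiable f x.
Proof.
move=> sf Ux; elim: sf => {f}.
- by move=> f sf; exact: smooth_on_differentiable Ux.
- by move=> c; exact: differentiable_cst.
- by move=> f g _ df _ dg; exact: differentiableD.
- by move=> f g _ df _ dg; exact: differentiableM.
- by move=> f _ df f0; apply: differentiableV => //; exact: f0.
- move=> W U' I e c f sc sf UU'.
  have dc i : differentiable (c i) x by exact: smooth_on_differentiable (sc i) Ux.
  apply: (@differentiable_comp _ _ _ _ (fun y => \sum_i c i y *: e i) f).
    exact: (@ex_diff _ _ _ _ _ _ _ (is_diff_combine _ e dc)).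
  exact: smooth_on_differentiable sf (UU' _ Ux).
Qed.

Lemma smooth_term_smooth f : smooth_term f -> smooth_on U f.
Proof.
apply: smooth_on_coind => // {}f; first by move=> + x; exact: smooth_term_differentiable.
move=> v; elim => {f}.
- by move=> f sf; exists ('D_v f) => //; exact/SmoothBase/smooth_on_derive.
- by move=> c; exists (fun=> 0) => [|x _]; [exact: SmoothCst|exact: derive_cst].
- move=> f g sf [f' sf' ff'] sg [g' sg' gg'].
  exists (fun x => f' x + g' x) => [|x Ux]; first exact: SmoothAdd.
  rewrite -ff'// -gg'//.
  by rewrite -deriveD//; exact/diff_derivable/smooth_term_differentiable.
- move=> f g sf [f' sf' ff'] sg [g' sg' gg'].
  exists (fun x => f x * g' x + g x * f' x) => [|x Ux].
    by apply: SmoothAdd; exact: SmoothMul.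
  rewrite -ff'// -gg'//.
  by rewrite -deriveM//; exact/diff_derivable/smooth_term_differentiable.
- move=> f sf [f' sf' ff'] f0.
  exists (fun x => (- 1) * ((f x)^-1 * (f x)^-1) * f' x) => [|x Ux].
    apply: SmoothMul => //; apply: SmoothMul; first exact: SmoothCst.
    by apply: SmoothMul; exact: SmoothInv.
  rewrite -ff'// deriveV ?f0//; last exact/diff_derivable/smooth_term_differentiable.
  by rewrite mulN1r -invfM -expr2.
- move=> W U' I e c f sc sf UU'.
  exists (fun x => \sum_i 'D_v (c i) x * 'D_(e i) f (\sum_i c i x *: e i)).
    apply: smooth_term_sum => i; apply: SmoothMul.
      exact/SmoothBase/smooth_on_derive.
    exact: (SmoothComp sc (smooth_on_derive (e i) sf) UU').
  move=> x Ux; apply: derive_combine.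
    by move=> i; exact: smooth_on_differentiable (sc i) Ux.
  exact: smooth_on_differentiable sf (UU' _ Ux).
Qed.

Lemma smooth_on_cst c : smooth_on U (fun=> c).
Proof. exact/smooth_term_smooth/SmoothCst. Qed.

Lemma smooth_onD f g : smooth_on U f -> smooth_on U g ->
  smooth_on U (fun x => f x + g x).
Proof. by move=> sf sg; apply/smooth_term_smooth/SmoothAdd; exact: SmoothBase. Qed.

Lemma smooth_onM f g : smooth_on U f -> smooth_on U g ->
  smooth_on U (fun x => f x * g x).
Proof. by move=> sf sg; apply/smooth_term_smooth/SmoothMul; exact: SmoothBase. Qed.

Lemma smooth_onN f : smooth_on U f -> smooth_on U (fun x => - f x).
Proof.
move=> sf; under [X in smooth_on _ X]funext do rewrite -mulN1r.
by apply: smooth_onM => //; exact: smooth_on_cst.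
Qed.

Lemma smooth_onB f g : smooth_on U f -> smooth_on U g ->
  smooth_on U (fun x => f x - g x).
Proof. by move=> sf sg; apply: smooth_onD => //; exact: smooth_onN. Qed.

Lemma smooth_onV f : smooth_on U f -> (forall x, U x -> f x != 0) ->
  smooth_on U (fun x => (f x)^-1).
Proof. by move=> sf f0; apply/smooth_term_smooth/SmoothInv => //; exact: SmoothBase. Qed.

Lemma smooth_onX f k : smooth_on U f -> smooth_on U (fun x => f x ^+ k).
Proof.
move=> sf; elim: k => [|k IH].
  by under [X in smooth_on _ X]funext do rewrite expr0; exact: smooth_on_cst.
by under [X in smooth_on _ X]funext do rewrite exprS; exact: smooth_onM.
Qed.

Lemma smooth_on_sum (I : Type) (r : seq I) (F : I -> V -> R) :
  (forall i, smooth_on U (F i)) -> smooth_on U (fun x => \sum_(i <- r) F i x).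
Proof.
by move=> sF; apply/smooth_term_smooth/smooth_term_sum => i; exact/SmoothBase/sF.
Qed.

Lemma smooth_on_prod (I : Type) (r : seq I) (F : I -> V -> R) :
  (forall i, smooth_on U (F i)) -> smooth_on U (fun x => \prod_(i <- r) F i x).
Proof.
move=> sF; elim: r => [|i r IH].
  by under [X in smooth_on _ X]funext do rewrite big_nil; exact: smooth_on_cst.
by under [X in smooth_on _ X]funext do rewrite big_cons; exact: smooth_onM.
Qed.

Lemma smooth_on_combine W (U' : set W) (I : finType) (e : I -> W)
    (c : I -> V -> R) (f : W -> R) :
  (forall i, smooth_on U (c i)) -> smooth_on U' f ->
  (forall x, U x -> U' (\sum_i c i x *: e i)) ->
  smooth_on U (fun x => f (\sum_i c i x *: e i)).
Proof. by move=> sc sf UU'; apply/smooth_term_smooth/(SmoothComp sc sf). Qed.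

(** The stable class consists of [f] and the constants, which are its derivatives. *)
Lemma smooth_on_linear (f : {linear V -> R}) : continuous f -> smooth_on U f.
Proof.
move=> cf; apply: (@smooth_on_coind _ _
  (fun g => g = f :> (V -> R) \/ exists c, g = fun=> c)) => //; last by left.
- move=> _ [->|[c ->]] x _; last exact: differentiable_cst.
  exact: linear_differentiable.
- move=> _ v [->|[c ->]].
    by exists (fun=> f v) => [|x _]; [by right; exists (f v)|rewrite deriveE ?diff_lin//;
      exact: linear_differentiable].
  by exists (fun=> 0) => [|x _]; [right; exists 0|exact: derive_cst].
Qed.

Section DerivativeRules.
Variables (x v : V) (Ux : U x).

Lemma smooth_deriveD f g : smooth_on U f -> smooth_on U g ->
  'D_v (fun y => f y + g y) x = 'D_v f x + 'D_v g x.
Proof. by move=> sf sg; rewrite -deriveD//; exact: smooth_on_derivable Ux. Qed.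

Lemma smooth_deriveM f g : smooth_on U f -> smooth_on U g ->
  'D_v (fun y => f y * g y) x = 'D_v f x * g x + f x * 'D_v g x.
Proof.
move=> sf sg; rewrite [X in X + _]mulrC [RHS]addrC.
by rewrite -[RHS]deriveM//; exact: smooth_on_derivable Ux.
Qed.

Lemma smooth_deriveZ c f : smooth_on U f ->
  'D_v (fun y => c * f y) x = c * 'D_v f x.
Proof.
move=> sf; rewrite smooth_deriveM//; last exact: smooth_on_cst.
by rewrite derive_cst mul0r add0r.
Qed.

Lemma smooth_deriveB f g : smooth_on U f -> smooth_on U g ->
  'D_v (fun y => f y - g y) x = 'D_v f x - 'D_v g x.
Proof. by move=> sf sg; rewrite -deriveB//; exact: smooth_on_derivable Ux. Qed.

Lemma smooth_derive_sum (I : Type) (r : seq I) (F : I -> V -> R) :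
  (forall i, smooth_on U (F i)) ->
  'D_v (fun y => \sum_(i <- r) F i y) x = \sum_(i <- r) 'D_v (F i) x.
Proof.
move=> sF; elim: r => [|i r IH].
  by under [X in derive X]funext do rewrite big_nil; rewrite big_nil derive_cst.
under [X in derive X]funext do rewrite big_cons.
by rewrite smooth_deriveD ?big_cons ?IH//; exact: smooth_on_sum.
Qed.

Lemma derive_directionD f u : smooth_on U f ->
  'D_(u + v) f x = 'D_u f x + 'D_v f x.
Proof.
by move=> /smooth_on_differentiable => /(_ _ Ux) df; rewrite !deriveE// linearD.
Qed.

Lemma derive_directionZ f c : smooth_on U f -> 'D_(c *: v) f x = c * 'D_v f x.
Proof.
by move=> /smooth_on_differentiable => /(_ _ Ux) df; rewrite !deriveE// linearZ.
Qed.

End DerivativeRules.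
End SmoothClosure.

(** The two difference quotients are the same function, so differentiability does not enter. *)
Lemma derive_slice V W (f : V -> W) (g : R -> W) (x v : V) (t : R) :
  (forall s, g s = f (x + s *: v)) -> 'D_1 g t = 'D_v f (x + t *: v).
Proof.
move=> gE; rewrite /derive; set d := (fun _ : R => _); set d' := (fun _ : R => _).
suff -> : d = d' by []; apply/funext => s; rewrite /d /d' /=.
by rewrite !gE [s *: 1]mulr1 scalerDl addrCA.
Qed.

Lemma derivable_slice V W (f : V -> W) (g : R -> W) (x v : V) (t : R) :
  (forall s, g s = f (x + s *: v)) ->
  derivable f (x + t *: v) v -> derivable g t 1.
Proof.
move=> gE; rewrite /derivable; set d := (fun _ : R => _); set d' := (fun _ : R => _).
suff -> : d = d' by []; apply/funext => s; rewrite /d /d' /=.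
by rewrite !gE [s *: 1]mulr1 scalerDl addrCA.
Qed.

Lemma line_MVT V (f : V -> R) (x v : V) :
  (forall t : R, 0 <= t <= 1 -> differentiable f (x + t *: v)) ->
  exists2 c : R, 0 < c < 1 & f (x + v) - f x = 'D_v f (x + c *: v).
Proof.
move=> df; pose g (t : R) := f (x + t *: v).
have dg (t : R) : 0 <= t <= 1 -> derivable g t 1.
  by move=> t01; apply: (@derivable_slice _ _ f _ x v) => //; exact/diff_derivable/df.
have g1 (t : R) : t \in `]0, 1[%R -> is_derive t 1 g ('D_1 g t).
  rewrite in_itv /= => /andP[t0 t1].
  by apply/derivableP/dg; rewrite !ltW.
have cg : {within `[0, 1], continuous g}.
  by apply: derivable_within_continuous => t; rewrite in_itv /=; exact: dg.
have [c c01] := MVT ltr01 g1 cg.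
rewrite subr0 mulr1 /g scale1r scale0r addr0 => ->.
by exists c; [move: c01; rewrite in_itv|exact: derive_slice].
Qed.

End SmoothFunctions.

(** * Symmetry of second derivatives *)

Section Schwarz.
Variables (R : realType) (V : normedModType R) (U : set V).
Hypothesis oU : open U.
Implicit Types (f : V -> R) (x v w : V).

Lemma differentiable_shift f x w :
  differentiable f (x + w) -> differentiable (fun y => f (y + w)) x.
Proof.
move=> df; apply: (@differentiable_comp _ _ _ _ (fun y => y + w) f) => //.
Qed.

Lemma derive_shiftE f x v w : 'D_v (fun y => f (y + w)) x = 'D_v f (x + w).
Proof.
rewrite /derive; set d := (fun _ : R => _); set d' := (fun _ : R => _).
by suff -> : d = d' by []; apply/funext => s; rewrite /d /d' /= addrA.
Qed.

(** Two mean value arguments: along [v] for [y |-> f (y + w) - f y], then along [w] for ['D_v f]. *)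
Lemma second_difference f x v w : smooth_on U f ->
  (forall s t : R, 0 <= s <= 1 -> 0 <= t <= 1 -> U (x + s *: v + t *: w)) ->
  exists s t : R, [/\ 0 <= s <= 1, 0 <= t <= 1 &
    f (x + v + w) - f (x + v) - (f (x + w) - f x) =
    'D_w ('D_v f) (x + s *: v + t *: w)].
Proof.
move=> sf UU.
have UU0 (s : R) : 0 <= s <= 1 -> U (x + s *: v).
  by move=> s01; have := UU s 0 s01; rewrite scale0r addr0 lexx ler01; exact.
have UU1 (s : R) : 0 <= s <= 1 -> U (x + s *: v + w).
  by move=> s01; have := UU s 1 s01; rewrite scale1r lexx ler01; exact.
have [|s /andP[s0 s1] sE] := @line_MVT R V (fun y => f (y + w) - f y) x v.
  move=> s s01; apply: differentiableB.
    by apply/differentiable_shift/(smooth_on_differentiable sf)/UU1.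
  exact/(smooth_on_differentiable sf)/UU0.
have s01 : 0 <= s <= 1 by rewrite !ltW.
have [|t /andP[t0 t1] tE] := @line_MVT R V ('D_v f) (x + s *: v) w.
  move=> t t01; apply/(smooth_on_differentiable (smooth_on_derive v sf)).
  exact: UU.
exists s, t; rewrite !ltW//; split=> //.
rewrite sE -tE deriveB ?derive_shiftE//.
  exact/diff_derivable/differentiable_shift/(smooth_on_differentiable sf)/UU1.
exact/diff_derivable/(smooth_on_differentiable sf)/UU0.
Qed.

Lemma derive2_directionZ f x v w (t : R) : smooth_on U f -> U x ->
  'D_(t *: w) ('D_(t *: v) f) x = t ^+ 2 * 'D_w ('D_v f) x.
Proof.
move=> sf Ux; have sfv := smooth_on_derive v sf.
rewrite (derive_directionZ w Ux t (smooth_on_derive (t *: v) sf)).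
rewrite (derive_ext (g := fun y => t * 'D_v f y) w oU)//.
  by rewrite (smooth_deriveZ oU w Ux t sfv) mulrA.
by move=> y Uy; exact: (derive_directionZ v Uy t sf).
Qed.

(* The second difference of f along t v and t w is t^2 times either mixed
   derivative, each evaluated at some point close to x. *)
Theorem smooth_derive_comm f x v w : smooth_on U f -> U x ->
  'D_v ('D_w f) x = 'D_w ('D_v f) x.
Proof.
move=> sf Ux; apply/eqP; rewrite -subr_eq0; apply: contraT => ne.
(* Half of the supposed discrepancy: two approximation errors below [e] cannot add up to it. *)
pose e := `|'D_v ('D_w f) x - 'D_w ('D_v f) x| / 2.
have e0 : 0 < e by rewrite divr_gt0// normr_gt0.
have near_cont g : smooth_on U g -> \forall y \near x, `|g x - g y| < e.
  move=> sg; have /cvgrPdist_lt := smooth_on_continuous sg Ux; exact.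
have ss1 := smooth_on_derive v (smooth_on_derive w sf).
have ss2 := smooth_on_derive w (smooth_on_derive v sf).
have /nbhs_ballP[r /= r0 dP] : \forall y \near x,
    [/\ U y, `|'D_v ('D_w f) x - 'D_v ('D_w f) y| < e &
            `|'D_w ('D_v f) x - 'D_w ('D_v f) y| < e].
  have := near_cont _ ss1; have := near_cont _ ss2.
  have := open_nbhs_nbhs (conj oU Ux : open_nbhs x U).
  by apply: filterS3 => y Uy y2 y1; split; [exact: Uy|exact: y1|exact: y2].
(* With [t * n = r], the parallelogram spanned by [t *: v] and [t *: w] stays in the ball of radius
   [r]; the summand 1 keeps [n] positive. *)
pose n := `|v| + `|w| + 1.
have n0 : 0 < n by rewrite ltr_wpDl// addr_ge0.
have [t t0 tn] : exists2 t : R, 0 < t & t * n = r.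
  by exists (r / n); [rewrite divr_gt0|rewrite divfK// gt_eqF].
have B (s s' : R) : 0 <= s <= 1 -> 0 <= s' <= 1 ->
    ball x r (x + s *: (t *: v) + s' *: (t *: w)).
  move=> /andP[s0 s1] /andP[s'0 s'1]; rewrite -ball_normE /= -addrA opprD addNKr.
  rewrite normrN (le_lt_trans (ler_normD _ _))// !normrZ.
  rewrite (gtr0_norm t0) !ger0_norm//.
  rewrite (@le_lt_trans _ _ (t * (`|v| + `|w|)))//.
    by rewrite mulrDr lerD// ler_piMl// mulr_ge0// ltW.
  by rewrite -tn ltr_pM2l// ltrDl.
have [|q1 [q2 [s1P s2P sE]]] := @second_difference f x (t *: v) (t *: w) sf.
  by move=> s s' sP s'P; have [] := dP _ (B _ _ sP s'P).
have [|r1 [r2 [r1P r2P rE]]] := @second_difference f x (t *: w) (t *: v) sf.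
  by move=> s s' sP s'P; rewrite addrAC; have [] := dP _ (B _ _ s'P sP).
have [Us _ eS] := dP _ (B _ _ s1P s2P).
have := dP _ (B _ _ r2P r1P); rewrite addrAC => -[Ur eR _].
rewrite (derive2_directionZ _ _ _ sf Us) in sE.
rewrite addrAC (derive2_directionZ _ _ _ sf Ur) addrAC in rE.
have E : 'D_w ('D_v f) (x + q1 *: (t *: v) + q2 *: (t *: w)) =
         'D_v ('D_w f) (x + r1 *: (t *: w) + r2 *: (t *: v)).
  apply: (@mulfI _ (t ^+ 2)); first by rewrite expf_neq0// gt_eqF.
  have alg (k l i j : R) : k - l - (i - j) = k - i - (l - j).
    by ring.
  apply: etrans (esym sE) (etrans _ rE).
  by rewrite [x + t *: w + t *: v]addrAC; exact: alg.
have : `|'D_v ('D_w f) x - 'D_w ('D_v f) x| < e + e.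
  rewrite -(subrKA ('D_w ('D_v f) (x + q1 *: (t *: v) + q2 *: (t *: w)))).
  apply: le_lt_trans (ler_normD _ _) _; apply: ltrD.
    by rewrite E; exact: eR.
  by rewrite distrC; exact: eS.
by rewrite /e -splitr ltxx.
Qed.

End Schwarz.

(** * Smooth functions of a point and of h *)

Section Cylinder.
Variables (R : realType) (V : normedModType R).
Implicit Types (U : set V) (f g : V * R -> R) (c : V -> R) (z v : V) (h : R).

Definition cyl U : set (V * R) := [set p | U p.1].

Lemma open_cyl U : open U -> open (cyl U).
Proof. by move=> oU; apply: open_comp => // p _; exact: cvg_fst. Qed.

Definition Dh f : V * R -> R := 'D_((0 : V), (1 : R)) f.

Arguments Dh f _ : simpl never.

Lemma derive_fst_slice f z v h : 'D_((v, 0) : V * R) f (z, h) = 'D_v (fun y => f (y, h)) z.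
Proof.
rewrite /derive; set d := (fun _ : R => _); set d' := (fun _ : R => _).
suff -> : d = d' by []; apply/funext => s; rewrite /d /d' /=; congr (_ *: (f _ - _)).
by congr (_, _); rewrite /= scaler0 add0r.
Qed.

Lemma Dh_slice f z h : Dh f (z, h) = derive1 (fun s => f (z, s)) h.
Proof.
rewrite /Dh /derive /derive1; set d := (fun _ : R => _); set d' := (fun _ : R => _).
suff -> : d = d' by []; apply/funext => s; rewrite /d /d' /=; congr (_ *: (f _ - _)).
by congr (_, _); rewrite /= ?scaler0 ?add0r// [s *: 1]mulr1.
Qed.

Lemma iter_Dh_slice f z k h : iter k Dh f (z, h) = derive1n k (fun s => f (z, s)) h.
Proof.
elim: k h => //= k IH h; rewrite Dh_slice; congr (derive1 _ h).
by apply/funext => s; rewrite IH.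
Qed.

Lemma derive_comp_fst c (q p : V * R) : 'D_q (fun p => c p.1) p = 'D_(q.1) c p.1.
Proof. by []. Qed.

Lemma derive_comp_snd (q p : V * R) : 'D_q (fun p => p.2 : R) p = q.2.
Proof.
have cs : continuous (snd : V * R -> R) by move=> q'; exact: cvg_snd.
rewrite deriveE; last exact: (@linear_differentiable _ _ _ snd).
by rewrite (@diff_lin _ _ _ snd).
Qed.

Lemma Dh_snd_exp k (p : V * R) : Dh (fun p => p.2 ^+ k : R) p = k%:R * p.2 ^+ k.-1.
Proof. by case: p => z h; rewrite Dh_slice /= exp_derive1. Qed.

Section Open.
Variables (U : set V) (oU : open U).
Let oC := open_cyl oU.

Lemma smooth_comp_fst c : smooth_on U c -> smooth_on (cyl U) (fun p => c p.1).
Proof.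
move=> sc; apply: (@smooth_on_coind _ _ _
  (fun f => exists2 c, smooth_on U c & f = fun p => c p.1)) => //; last by exists c.
- move=> _ [{}c {}sc ->] p Up; apply: (@differentiable_comp _ _ _ _ fst c).
    by apply: (@linear_differentiable _ _ _ fst) => q; exact: cvg_fst.
  exact: (smooth_on_differentiable sc).
- move=> _ q [{}c {}sc ->]; exists (fun p => 'D_(q.1) c p.1) => //.
  by exists ('D_(q.1) c) => //; exact: smooth_on_derive.
Qed.

Lemma smooth_slice f h : smooth_on (cyl U) f -> smooth_on U (fun z => f (z, h)).
Proof.
move=> sf; apply: (@smooth_on_coind _ _ _
  (fun c => exists2 f, smooth_on (cyl U) f & c = fun z => f (z, h))) => //; last by exists f.
- move=> _ [{}f {}sf ->] z Uz; apply: (@differentiable_comp _ _ _ _ (fun z => (z, h)) f).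
    by apply: differentiable_pair => //; exact: differentiable_cst.
  exact: (smooth_on_differentiable sf).
- move=> _ v [{}f {}sf ->]; exists (fun z => 'D_((v, 0) : V * R) f (z, h)).
    by exists ('D_((v, 0) : V * R) f) => //; exact: smooth_on_derive.
  by move=> z _; rewrite derive_fst_slice.
Qed.

Lemma smooth_snd : smooth_on (cyl U) (fun p => p.2 : R).
Proof. by apply: (@smooth_on_linear _ _ _ _ snd) => // p; exact: cvg_snd. Qed.

Lemma smooth_Dh f : smooth_on (cyl U) f -> smooth_on (cyl U) (Dh f).
Proof. exact: smooth_on_derive. Qed.

Lemma smooth_iter_Dh k f : smooth_on (cyl U) f -> smooth_on (cyl U) (iter k Dh f).
Proof. by move=> sf; elim: k => //= k IH; exact: smooth_Dh. Qed.

Lemma Dh_ext f g : (forall p, cyl U p -> f p = g p) ->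
  forall p, cyl U p -> Dh f p = Dh g p.
Proof. by move=> fg p Up; exact: (derive_ext _ oC fg Up). Qed.

Lemma DhD f g p : cyl U p -> smooth_on (cyl U) f -> smooth_on (cyl U) g ->
  Dh (fun p => f p + g p) p = Dh f p + Dh g p.
Proof. by move=> Up; exact: smooth_deriveD. Qed.

Lemma DhM f g p : cyl U p -> smooth_on (cyl U) f -> smooth_on (cyl U) g ->
  Dh (fun p => f p * g p) p = Dh f p * g p + f p * Dh g p.
Proof. by move=> Up; exact: smooth_deriveM. Qed.

Lemma DhZ a f p : cyl U p -> smooth_on (cyl U) f ->
  Dh (fun p => a * f p) p = a * Dh f p.
Proof. by move=> Up; exact: smooth_deriveZ. Qed.

Lemma Dh_sum (I : Type) (r : seq I) (F : I -> V * R -> R) p : cyl U p ->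
  (forall i, smooth_on (cyl U) (F i)) ->
  Dh (fun p => \sum_(i <- r) F i p) p = \sum_(i <- r) Dh (F i) p.
Proof. by move=> Up; exact: smooth_derive_sum. Qed.

Lemma iter_Dh_ext k f g : (forall p, cyl U p -> f p = g p) ->
  forall p, cyl U p -> iter k Dh f p = iter k Dh g p.
Proof. by move=> fg; elim: k => //= k IH p Up; exact: Dh_ext Up. Qed.

Lemma iter_DhD k f g p : smooth_on (cyl U) f -> smooth_on (cyl U) g -> cyl U p ->
  iter k Dh (fun p => f p + g p) p = iter k Dh f p + iter k Dh g p.
Proof.
move=> sf sg; elim: k p => //= k IH p Up.
by rewrite (Dh_ext IH Up) DhD//; exact: smooth_iter_Dh.
Qed.

Lemma iter_DhZ k a f p : smooth_on (cyl U) f -> cyl U p ->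
  iter k Dh (fun p => a * f p) p = a * iter k Dh f p.
Proof.
move=> sf; elim: k p => //= k IH p Up.
by rewrite (Dh_ext IH Up) DhZ//; exact: smooth_iter_Dh.
Qed.

Lemma iter_Dh_sum k (I : Type) (r : seq I) (F : I -> V * R -> R) p :
  (forall i, smooth_on (cyl U) (F i)) -> cyl U p ->
  iter k Dh (fun p => \sum_(i <- r) F i p) p = \sum_(i <- r) iter k Dh (F i) p.
Proof.
move=> sF; elim: k p => //= k IH p Up.
by rewrite (Dh_ext IH Up) Dh_sum// => i; exact: smooth_iter_Dh.
Qed.

Lemma smooth_monomial k c : smooth_on U c ->
  smooth_on (cyl U) (fun p => p.2 ^+ k * c p.1).
Proof.
move=> sc; apply: (smooth_onM oC); last exact: smooth_comp_fst.
exact/(smooth_onX oC)/smooth_snd.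
Qed.

Lemma iter_Dh_monomial i k c p : smooth_on U c -> cyl U p ->
  iter i Dh (fun p => p.2 ^+ k * c p.1) p = (k ^_ i)%:R * (p.2 ^+ (k - i) * c p.1).
Proof.
move=> sc; elim: i p => [|i IH] p Up; first by rewrite ffactn0 mul1r subn0.
rewrite [LHS](Dh_ext IH Up) DhZ//; last exact: smooth_monomial.
rewrite DhM//; [|exact/(smooth_onX oC)/smooth_snd|exact: smooth_comp_fst].
rewrite [X in _ + _ * X](derive_comp_fst _ (0, 1)) /= derive0 mulr0 addr0.
rewrite -/(Dh _) Dh_snd_exp ffactnSr natrM -!mulrA; congr (_ * _).
by rewrite subnS.
Qed.

Lemma iter_Dh_monomial0 i k c z : smooth_on U c -> U z ->
  iter i Dh (fun p => p.2 ^+ k * c p.1) (z, 0) = if i == k then k`!%:R * c z else 0.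
Proof.
move=> sc Uz; rewrite iter_Dh_monomial//=; case: ltngtP => ik.
- by rewrite expr0n subn_eq0 leqNgt ik mul0r mulr0.
- by rewrite ffact_small// mul0r.
- by rewrite ik ffactnn subnn expr0 mul1r.
Qed.

(** The Taylor coefficient in h at h = 0, in the form used by [substitute]; [iter_Dh_slice] links
    the two. *)
Definition hcoef k f z : R := (k`!%:R)^-1 * iter k Dh f (z, 0).

Lemma smooth_hcoef k f : smooth_on (cyl U) f -> smooth_on U (hcoef k f).
Proof.
move=> sf; apply: (smooth_onM oU); first exact: (smooth_on_cst oU).
exact/smooth_slice/smooth_iter_Dh.
Qed.

Lemma smooth_hpoly N (c : nat -> V -> R) : (forall k, (k <= N)%N -> smooth_on U (c k)) ->
  smooth_on (cyl U) (fun p => \sum_(k < N.+1) p.2 ^+ k * c k p.1).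
Proof.
by move=> sc; apply: (smooth_on_sum oC) => k; apply/smooth_monomial/sc; rewrite -ltnS.
Qed.

Lemma hcoef_hpoly N (c : nat -> V -> R) k z : (forall k, (k <= N)%N -> smooth_on U (c k)) ->
  U z -> (k <= N)%N -> hcoef k (fun p => \sum_(i < N.+1) p.2 ^+ i * c i p.1) z = c k z.
Proof.
move=> sc Uz kN; have sc' (i : 'I_N.+1) : smooth_on U (c i) by apply: sc; rewrite -ltnS.
rewrite /hcoef iter_Dh_sum// => [|i]; last exact: smooth_monomial.
under eq_bigr do rewrite iter_Dh_monomial0//.
rewrite -big_mkcond /= (big_pred1 (inord k)) => [|i].
  by rewrite inordK// mulKf// pnatr_eq0 -lt0n fact_gt0.
by apply/eqP/eqP => [->|->]; [rewrite inord_val|rewrite inordK].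
Qed.

End Open.
End Cylinder.
Arguments Dh {R V} f _ : simpl never.

(** * Functions vanishing to a given order in h *)

Section Flat.
Variables (R : realType) (V : normedModType R) (U : set V).
Hypothesis oU : open U.
Implicit Types (f g : V * R -> R) (c : V -> R) (z v : V) (h : R).
Local Notation C := (cyl U).
Let oC := open_cyl oU.

(** A mere bound by a multiple of h^k would not survive differentiation in z; the bound is recovered
    at the end by [hflat_bigO]. *)
Definition hflat k f : Prop :=
  forall i, (i < k)%N -> forall z, U z -> iter i Dh f (z, 0) = 0.

Lemma hflatS k f :
  hflat k.+1 f <-> (forall z, U z -> f (z, 0) = 0) /\ hflat k (Dh f).
Proof.
split=> [ff|[f0 ff] [|i] ik z Uz].
- split=> [z|i ik z Uz]; first exact: (ff 0%N).
  by rewrite -iterSr; exact: ff.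
- exact: f0.
- by rewrite iterSr; exact: ff.
Qed.

Lemma hflat_le k l f : (l <= k)%N -> hflat k f -> hflat l f.
Proof. by move=> lk ff i il; apply: ff; exact: leq_trans lk. Qed.

Lemma hflat_ext k f g : (forall p, C p -> f p = g p) -> hflat k f -> hflat k g.
Proof. by move=> fg ff i ik z Uz; rewrite -(iter_Dh_ext oU i fg)// ff. Qed.

Lemma hflat_cst0 k : hflat k (fun=> 0).
Proof.
elim: k => // k IH; apply/hflatS; split=> //.
by apply: hflat_ext IH => p _; rewrite /Dh derive_cst.
Qed.

Lemma hflatD k f g : smooth_on C f -> smooth_on C g ->
  hflat k f -> hflat k g -> hflat k (fun p => f p + g p).
Proof. by move=> sf sg ff fg i ik z Uz; rewrite (iter_DhD oU)// ff// fg// addr0. Qed.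

Lemma hflatZ k a f : smooth_on C f -> hflat k f -> hflat k (fun p => a * f p).
Proof. by move=> sf ff i ik z Uz; rewrite (iter_DhZ oU)// ff// mulr0. Qed.

Lemma hflatN k f : smooth_on C f -> hflat k f -> hflat k (fun p => - f p).
Proof.
move=> sf /(hflatZ (-1) sf); apply: hflat_ext => p _; exact: mulN1r.
Qed.

Lemma hflatB k f g : smooth_on C f -> smooth_on C g ->
  hflat k f -> hflat k g -> hflat k (fun p => f p - g p).
Proof.
by move=> sf sg ff fg; apply: hflatD => //; [exact: smooth_onN|exact: hflatN].
Qed.

Lemma hflat_sum k (I : Type) (r : seq I) (F : I -> V * R -> R) :
  (forall i, smooth_on C (F i)) -> (forall i, hflat k (F i)) ->
  hflat k (fun p => \sum_(i <- r) F i p).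
Proof.
move=> sF fF i ik z Uz; rewrite (iter_Dh_sum oU)//.
by apply: big1 => j _; exact: fF.
Qed.

(** By the Leibniz rule each term of the h-derivative has one factor whose order drops by one, and
    the orders still add up to [k] after the step. An order 0 carries no information, so the
    predecessor is harmless there. *)
Lemma hflat_mul k a b f g : (k <= a + b)%N -> smooth_on C f -> smooth_on C g ->
  hflat a f -> hflat b g -> hflat k (fun p => f p * g p).
Proof.
elim: k a b f g => // k IH a b f g kab sf sg ff fg; apply/hflatS; split.
  move=> z Uz; case: a kab ff => [|a] kab ff.
    by case: b kab fg => // b _ /hflatS[-> //]; rewrite mulr0.
  by case/hflatS: ff => -> //; rewrite mul0r.
apply: (@hflat_ext _ (fun p => Dh f p * g p + f p * Dh g p)) => [p Cp|].
  by rewrite (DhM Cp).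
have pred_flat d u : hflat d u -> hflat d.-1 (Dh u).
  by case: d => // d /hflatS[].
have sDf := smooth_Dh sf; have sDg := smooth_Dh sg.
apply: hflatD; [exact: (smooth_onM oC)|exact: (smooth_onM oC)| |].
- apply: (IH a.-1 b) => //; last exact: pred_flat.
  by case: a kab {ff} => [|a] //= kab; exact: ltnW.
- apply: (IH a b.-1) => //; last exact: pred_flat.
  by case: b kab {fg} => [|b] /=; [rewrite addn0 => /ltnW|rewrite addnS].
Qed.

Lemma hflatMl k f g : smooth_on C f -> smooth_on C g -> hflat k f ->
  hflat k (fun p => f p * g p).
Proof. by move=> sf sg ff; apply: (@hflat_mul k k 0) => //; rewrite addn0. Qed.

Lemma hflatMr k f g : smooth_on C f -> smooth_on C g -> hflat k g ->
  hflat k (fun p => f p * g p).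
Proof. by move=> sf sg ff; apply: (@hflat_mul k 0 k). Qed.

Lemma hflat_expM k i f : smooth_on C f -> hflat k f ->
  hflat (i + k) (fun p => p.2 ^+ i * f p).
Proof.
move=> sf ff; apply: (@hflat_mul _ i k) => //.
  exact/(smooth_onX oC)/smooth_snd.
move=> j ji z Uz; have s1 : smooth_on U (fun=> 1 : R) by exact: (smooth_on_cst oU).
have := iter_Dh_monomial0 oU j i s1 Uz; rewrite ltn_eqF//; apply: etrans.
by apply: (iter_Dh_ext oU) => // p _; rewrite mulr1.
Qed.

(** A function vanishing on the slice h = 0 has zero derivatives inside the slice, and [Dh] commutes
    with these by the symmetry of second derivatives; hence no order is lost. *)
Lemma hflat_derive_fst k f v : smooth_on C f -> hflat k f ->
  hflat k ('D_((v, 0) : V * R) f).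
Proof.
elim: k f => // k IH f sf /hflatS[f0 ff]; apply/hflatS; split.
  move=> z Uz; rewrite derive_fst_slice (derive_ext (g := fun=> 0) v oU)//.
  exact: derive_cst.
apply: hflat_ext (IH _ (smooth_Dh sf) ff) => p Cp.
exact: (smooth_derive_comm oC).
Qed.

(** The h-component of the direction costs one order. *)
Lemma hflat_derive k f (q : V * R) : smooth_on C f -> hflat k.+1 f ->
  hflat k ('D_q f).
Proof.
case: q => v t sf ff.
have sv := smooth_on_derive ((v, 0) : V * R) sf; have s1 := smooth_Dh sf.
apply: (@hflat_ext _ (fun p => 'D_((v, 0) : V * R) f p + t * Dh f p)) => [p Cp|].
  have -> : (v, t) = (v, 0) + t *: ((0 : V), (1 : R)) :> V * R.
    by congr (_, _); rewrite /= ?scaler0 ?addr0// add0r [_ *: _]mulr1.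
  by rewrite (derive_directionD _ Cp) ?(derive_directionZ _ Cp).
apply: hflatD => //.
- exact: (smooth_onM oC (smooth_on_cst oC t)).
- by apply: hflat_le (hflat_derive_fst v sf ff).
- by apply: hflatZ => //; case/hflatS: ff.
Qed.

Lemma hcoef_eq k N f g z : smooth_on C f -> smooth_on C g -> U z -> (k <= N)%N ->
  hflat N.+1 (fun p => f p - g p) -> hcoef k f z = hcoef k g z.
Proof.
move=> sf sg Uz kN /(_ k kN z Uz) /=; rewrite (iter_DhD oU)//; last exact: smooth_onN.
move=> /eqP; rewrite addr_eq0 => /eqP; rewrite /hcoef => ->.
have -> : iter k Dh (fun p => - g p) (z, 0) = - iter k Dh g (z, 0).
  rewrite -mulN1r -(iter_DhZ oU)//.
  by apply: (iter_Dh_ext oU) => // p _; rewrite mulN1r.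
by rewrite opprK.
Qed.

Lemma hflat_taylor N f : smooth_on C f ->
  hflat N.+1 (fun p => f p - \sum_(k < N.+1) p.2 ^+ k * hcoef k f p.1).
Proof.
move=> sf i iN z Uz.
pose P (p : V * R) := \sum_(k < N.+1) p.2 ^+ k * hcoef k f p.1.
rewrite -[fun p => f p - _]/(fun p => f p + - P p).
have sc k : (k <= N)%N -> smooth_on U (hcoef k f) by move=> _; exact: smooth_hcoef.
have sP : smooth_on C P by exact: (smooth_hpoly oU sc).
rewrite (iter_DhD oU i sf (smooth_onN oC sP) (Uz : C (z, 0))).
have -> : iter i Dh (fun p => - P p) (z, 0) = - iter i Dh P (z, 0).
  rewrite -mulN1r -(iter_DhZ oU)//.
  by apply: (iter_Dh_ext oU) => // p _; rewrite mulN1r.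
have := hcoef_hpoly oU sc Uz iN; rewrite /hcoef.
have fn0 : (i`!%:R : R) != 0 by rewrite pnatr_eq0 -lt0n fact_gt0.
by move/(mulfI (invr_neq0 fn0)) => ->; rewrite subrr.
Qed.

(** The mean value theorem on the segment from [(z, 0)] to [(z, h)] yields one factor [|h|] for each
    vanishing derivative; continuity gives the uniform bound at order 0. *)
Lemma hflat_bigO k f z0 : smooth_on C f -> hflat k f -> U z0 ->
  exists K : R, \forall z \near z0 & h \near (0 : R), `|f (z, h)| <= K * `|h| ^+ k.
Proof.
move=> + + Uz0; elim: k f => [|k IH] f sf ff.
  exists (`|f (z0, 0)| + 1).
  have := smooth_on_continuous sf (Uz0 : C (z0, 0)).
  move/cvgrPdist_le => /(_ 1 ltr01); apply: filterS => -[z h] /= fzh; rewrite expr0 mulr1.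
  rewrite -[f (z, h)](subKr (f (z0, 0))) (le_trans (ler_normB _ _))//.
  by rewrite lerD2l.
have /hflatS[f0 {}/(IH _ (smooth_Dh sf))[K]] := ff.
move=> [[A B] /= [nA /nbhs_ballP[e /= e0 eB]] AB].
(* A ball in h contains the intermediate value [t * h] together with [h]. The absolute value covers
   a negative [K]. *)
exists `|K|; exists (A `&` U, ball 0 e) => /=.
  by split; [apply: filterI => //; exact: open_nbhs_nbhs|exact: nbhsx_ballx].
move=> [z h] /= [[Az Uz] eh].
have [|t /andP[t0 t1]] := @line_MVT _ _ f (z, 0) (0, h).
  move=> t _; apply: (smooth_on_differentiable sf).
  by rewrite /C /= scaler0 addr0.
have -> : (z, 0) + (0, h) = (z, h) :> V * R by congr (_, _); rewrite /= ?addr0 ?add0r.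
have -> : (z, 0) + t *: (0, h) = (z, t * h) :> V * R.
  by congr (_, _); rewrite /= ?scaler0 ?addr0 ?add0r.
have -> : (0, h) = h *: ((0 : V), (1 : R)) :> V * R.
  by congr (_, _); rewrite /= ?scaler0// [_ *: _]mulr1.
rewrite f0// subr0 (derive_directionZ _ (Uz : C (z, t * h)))// => ->.
rewrite normrM exprS mulrCA ler_wpM2l//.
have th : `|t * h| <= `|h| by rewrite normrM gtr0_norm// ler_piMl// ltW.
apply: le_trans (AB (z, t * h) _) _.
  split=> //=; apply: eB; move: eh; rewrite -!ball_normE /= !sub0r !normrN.
  exact: le_lt_trans.
apply: (@le_trans _ _ (`|K| * `|t * h| ^+ k)).
  by rewrite ler_wpM2r ?exprn_ge0 ?ler_norm.
by rewrite ler_wpM2l// lerXn2r// nnegrE.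
Qed.

End Flat.

Section FlatComposition.
Variables (R : realType) (V W : normedModType R) (U : set V) (U' : set W).
Hypotheses (oU : open U) (oU' : open U').
Let oC := open_cyl oU.
Let oC' := open_cyl oU'.

(** The inner map preserves h, so it sends the slice h = 0 to the slice h = 0. By the chain rule the
    h-derivative is a sum of directional derivatives of [E], each flat to one order less. *)
Lemma hflat_comp k (I : finType) (e : I -> W * R) (g : I -> V * R -> R)
    (E : W * R -> R) :
  (forall i, smooth_on (cyl U) (g i)) -> smooth_on (cyl U') E ->
  (forall p, cyl U p -> cyl U' (\sum_i g i p *: e i)) ->
  (forall p, cyl U p -> (\sum_i g i p *: e i).2 = p.2) ->
  hflat U' k E -> hflat U k (fun p => E (\sum_i g i p *: e i)).
Proof.
move=> sg + CC G2; elim: k E => // k IH E sE fE; apply/hflatS; split.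
  move=> z Uz; have := G2 (z, 0) Uz; have := CC (z, 0) Uz.
  case: (\sum_i _) => w t /= + ->.
  by case/hflatS: fE => E0 _; exact: E0.
have sEe i := smooth_on_derive (e i) sE.
have sc i : smooth_on (cyl U) (fun p => 'D_(e i) E (\sum_j g j p *: e j)).
  exact: (smooth_on_combine oC sg (sEe i) CC).
apply: (hflat_ext oU (f := fun p =>
    \sum_i Dh (g i) p * 'D_(e i) E (\sum_j g j p *: e j))).
  move=> p Cp; rewrite /Dh derive_combine//.
    by move=> i; exact: smooth_on_differentiable (sg i) Cp.
  exact: smooth_on_differentiable sE (CC _ Cp).
apply: (hflat_sum oU) => i; first exact/(smooth_onM oC)/sc/smooth_Dh/sg.
apply: (hflatMr oU); [exact/smooth_Dh/sg|exact: sc|].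
exact: (IH _ (sEe i) (hflat_derive oU' _ sE fE)).
Qed.

End FlatComposition.

(** Differentiating in h and splitting the difference of products leaves [(F i)' - (G i)'], flat by
    hypothesis, and the same difference for a derivative of [r] at one order less. Hence the
    induction ranges over all smooth [r]. *)
Lemma hflat_comp_sub (R : realType) (V W : normedModType R) (U : set V)
    (U' : set W) (oU : open U) k (I : finType) (e : I -> W)
    (F G : I -> V * R -> R) (r : W -> R) :
  (forall i, smooth_on (cyl U) (F i)) -> (forall i, smooth_on (cyl U) (G i)) ->
  smooth_on U' r ->
  (forall p, cyl U p -> U' (\sum_i F i p *: e i)) ->
  (forall p, cyl U p -> U' (\sum_i G i p *: e i)) ->
  (forall i, hflat U k (fun p => F i p - G i p)) ->
  hflat U k (fun p => r (\sum_i F i p *: e i) - r (\sum_i G i p *: e i)).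
Proof.
move=> sF sG + UF UG; elim: k r => // k IH r sr fFG; apply/hflatS; split.
  move=> z Uz; apply/eqP; rewrite subr_eq0; apply/eqP; congr r.
  apply: eq_bigr => i _; congr (_ *: _).
  by have /hflatS[/(_ z Uz)/eqP] := fFG i; rewrite subr_eq0 => /eqP.
have oC := open_cyl oU.
have se i := smooth_on_derive (e i) sr.
have scF f : smooth_on U' f -> smooth_on (cyl U) (fun p => f (\sum_j F j p *: e j)).
  by move=> sf; exact: (smooth_on_combine oC sF sf UF).
have scG f : smooth_on U' f -> smooth_on (cyl U) (fun p => f (\sum_j G j p *: e j)).
  by move=> sf; exact: (smooth_on_combine oC sG sf UG).
have sDF i := smooth_Dh (sF i); have sDG i := smooth_Dh (sG i).
pose a i p := 'D_(e i) r (\sum_j F j p *: e j) : R.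
pose b i p := 'D_(e i) r (\sum_j G j p *: e j) : R.
apply: (hflat_ext oU (f := fun p =>
    \sum_i (Dh (F i) p * (a i p - b i p) + (Dh (F i) p - Dh (G i) p) * b i p))).
  move=> p Cp; have dF i := smooth_on_differentiable (sF i) Cp.
  have dG i := smooth_on_differentiable (sG i) Cp.
  rewrite /Dh (smooth_deriveB _ Cp (scF _ sr) (scG _ sr)).
  rewrite (derive_combine dF) ?(derive_combine dG).
  + rewrite -sumrB; apply: eq_bigr => i _; rewrite /a /b /Dh.
    by rewrite mulrBr mulrBl addrA subrK.
  + exact: smooth_on_differentiable sr (UG _ Cp).
  + exact: smooth_on_differentiable sr (UF _ Cp).
have sa i : smooth_on (cyl U) (a i) := scF _ (se i).
have sb i : smooth_on (cyl U) (b i) := scG _ (se i).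
have sab i := smooth_onB oC (sa i) (sb i).
have sDFG i := smooth_onB oC (sDF i) (sDG i).
apply: (hflat_sum oU) => i.
  by apply: (smooth_onD oC); exact: (smooth_onM oC).
apply: (hflatD oU); [exact: (smooth_onM oC)|exact: (smooth_onM oC)| |].
- apply: (hflatMr oU) => //; apply: (IH _ (se i)) => j.
  by apply: hflat_le (fFG j).
- apply: (hflatMl oU) => //; have /hflatS[_] := fFG i.
  apply: (hflat_ext oU) => p Cp; exact: (smooth_deriveB _ Cp).
Qed.

Lemma smooth_on_det (R : realType) (V : normedModType R) (U : set V) d
    (A : V -> 'M[R]_d) : open U ->
  (forall i j, smooth_on U (fun x => A x i j)) -> smooth_on U (fun x => \det (A x)).
Proof.
move=> oU sA; rewrite /determinant; apply: (smooth_on_sum oU) => s.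
apply: (smooth_onM oU); first exact: (smooth_on_cst oU).
by apply: (smooth_on_prod oU) => i; exact: sA.
Qed.

Lemma smooth_on_adj (R : realType) (V : normedModType R) (U : set V) d
    (A : V -> 'M[R]_d) i j : open U ->
  (forall i j, smooth_on U (fun x => A x i j)) -> smooth_on U (fun x => (\adj (A x)) i j).
Proof.
move=> oU sA; apply: (smooth_on_ext oU (f := fun x =>
  (-1) ^+ (j + i) * \det (row' j (col' i (A x))))).
  by move=> x _; rewrite mxE.
apply: (smooth_onM oU); first exact: (smooth_on_cst oU).
apply: smooth_on_det => // k l.
by apply: smooth_on_ext oU _ (sA (lift j k) (lift i l)) => x _; rewrite !mxE.
Qed.

(** * Locally uniform bounds in h *)

Section BigO.
Variables (R : realType) (m : nat) (U : set 'rV[R]_m).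
Hypothesis oU : open U.
Local Notation Z := 'rV[R]_m.
Implicit Types (V : normedModType R) (f g : R -> Z -> R).

Lemma bigO_h_near V d (f g : R -> Z -> V) :
  (forall z0, U z0 -> \forall z \near z0 & h \near (0 : R), f h z = g h z) ->
  bigO_h U d f -> bigO_h U d g.
Proof.
move=> fg fO z0 Uz; have [K fK] := fO z0 Uz; exists K.
by apply: filterS2 (fg z0 Uz) fK => -[z h] /= ->.
Qed.

Lemma bigO_hD V d (f g : R -> Z -> V) : bigO_h U d f -> bigO_h U d g ->
  bigO_h U d (fun h z => f h z + g h z).
Proof.
move=> fO gO z0 Uz; have [K fK] := fO z0 Uz; have [K' gK] := gO z0 Uz.
exists (K + K'); apply: filterS2 fK gK => -[z h] /= fK gK.
by rewrite mulrDl (le_trans (ler_normD _ _))// lerD.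
Qed.

Lemma bigO_h_sum V d (I : Type) (r : seq I) (F : I -> R -> Z -> V) :
  (forall i, bigO_h U d (F i)) -> bigO_h U d (fun h z => \sum_(i <- r) F i h z).
Proof.
move=> FO; elim: r => [|i r IH].
  move=> z0 _; exists 0; near=> p; by rewrite /= big_nil normr0 mul0r.
have := bigO_hD (FO i) IH; apply: bigO_h_near => z0 _.
by near=> p; rewrite /= big_cons.
Unshelve. all: by end_near. Qed.

Lemma bigO_h_mx d p q (A : R -> Z -> 'M[R]_(p, q)) :
  (forall i j, bigO_h U d (fun h z => A h z i j)) -> bigO_h U d A.
Proof.
move=> AO; have := bigO_h_sum (index_enum 'I_p) (fun i =>
  bigO_h_sum (index_enum 'I_q) (F := fun j h z => A h z i j *: delta_mx i j) _).
move=> /(_ d); have AOd i j : bigO_h U d (fun h z => A h z i j *: (delta_mx i j : 'M[R]_(p, q))).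
  move=> z0 Uz; have [K AK] := AO i j z0 Uz; exists (K * `|delta_mx i j : 'M[R]_(p, q)|).
  by apply: filterS AK => -[z h] /= AK; rewrite normrZ mulrAC ler_wpM2r.
move=> /(_ AOd); apply: bigO_h_near => z0 _.
by near=> x; rewrite /= -matrix_sum_delta.
Unshelve. all: by end_near. Qed.

Lemma bigO_hM d f g : bigO_h U d f -> bigO_h U 0 g ->
  bigO_h U d (fun h z => f h z * g h z).
Proof.
move=> fO gO z0 Uz; have [K fK] := fO z0 Uz; have [K' gK] := gO z0 Uz.
exists (K * K'); apply: filterS2 fK gK => -[z h] /=; rewrite expr0 mulr1 => fK gK.
by rewrite normrM mulrAC ler_pM.
Qed.

Lemma bigO_h_flat d f : smooth_on (cyl U) (fun p => f p.2 p.1) ->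
  hflat U d (fun p => f p.2 p.1) -> bigO_h U d f.
Proof.
by move=> sf ff z0 Uz; have [K fK] := hflat_bigO oU sf ff Uz; exists K.
Qed.

Section InverseBound.
Variables (d : nat) (A : R -> Z -> 'M[R]_d).
Hypothesis sA : forall i j, smooth_on (cyl U) (fun p => A p.2 p.1 i j).
Hypothesis A0 : forall z, U z -> A 0 z \in unitmx.
Let oC := open_cyl oU.
Let sdet := smooth_on_det oC sA.

(** The determinant is continuous in [(z, h)] and nonzero at h = 0. *)
Lemma near_h0_unit : near_h0 U (fun h z => A h z \in unitmx).
Proof.
move=> z0 Uz; have d0 : \det (A 0 z0) != 0 by rewrite -unitfE -unitmxE A0.
have := smooth_on_continuous sdet (Uz : cyl U (z0, 0)).
move=> /cvgrPdist_lt /(_ `|\det (A 0 z0)|); rewrite normr_gt0 => /(_ d0).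
apply: filterS => -[z h] /= dlt; rewrite unitmxE unitfE.
by apply: contraTneq dlt => ->; rewrite subr0 ltxx.
Qed.

(** Order 0 means local boundedness. By Cramer's rule the inverse is the adjugate times the inverse
    determinant, both continuous near h = 0. *)
Lemma bigO_h_invmx i j : bigO_h U 0 (fun h z => invmx (A h z) i j).
Proof.
apply: (@bigO_h_near _ _ (fun h z => (\adj (A h z)) i j * (\det (A h z))^-1)).
  move=> z0 Uz; apply: filterS (near_h0_unit Uz) => -[z h] /= u.
  by rewrite /invmx u [RHS]mxE mulrC.
apply: bigO_hM.
  exact: (bigO_h_flat (f := fun h z => (\adj (A h z)) i j) (smooth_on_adj i j oC sA)).
move=> z0 Uz; have d0 : \det (A 0 z0) != 0 by rewrite -unitfE -unitmxE A0.
exists (`|(\det (A 0 z0))^-1| + 1).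
have cV : {for (z0, 0 : R), continuous (fun p : Z * R => (\det (A p.2 p.1))^-1)}.
  by apply: cvgV => //; exact: (smooth_on_continuous sdet (Uz : cyl U (z0, 0))).
have /cvgrPdist_le := cV => /(_ 1 ltr01); apply: filterS => -[z h] /= dh.
rewrite expr0 mulr1 -[X in `|X| <= _](subKr (\det (A 0 z0))^-1).
by rewrite (le_trans (ler_normB _ _))// lerD2l.
Qed.

End InverseBound.
End BigO.

(** * Functions on jet spaces *)

Lemma smooth_on_entry (R : realType) p q (U : set 'M[R]_(p, q)) (k : 'I_p) (j : 'I_q) :
  open U -> smooth_on U (fun A => A k j).
Proof.
move=> oU; have @F : {linear 'M[R]_(p, q) -> R}.
  by exists (fun N : 'M[R]_(_, _) => N k j); do 2![eexists]; do ?[constructor];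
     rewrite ?mxE// => ? *; rewrite ?mxE//; move=> ?; rewrite !mxE.
rewrite (_ : (fun _ => _) = F)//; apply: smooth_on_linear => //.
exact: coord_continuous.
Qed.

Section JetFunctions.
Variables (R : realType) (n : nat) (Q : set 'rV[R]_n).
Hypothesis oQ : open Q.
Implicit Types (J : jet R n) (f g : R -> jet R n -> R) (m : nat).

Definition eq_jet m J J' : Prop := forall k, (k <= m)%N -> J k = J' k.

Definition jet_of_mx m (A : 'M[R]_(m.+1, n)) : jet R n :=
  fun k => if (k <= m)%N then row (inord k) A else 0.

Definition mx_dom m : set 'M[R]_(m.+1, n) := [set A | Q (row ord0 A)].
Arguments mx_dom : clear implicits.

Lemma jet_truncK m J : eq_jet m (jet_of_mx (jet_trunc m J)) J.
Proof.
by move=> k km; rewrite /jet_of_mx km; apply/rowP => j; rewrite !mxE inordK.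
Qed.

Lemma jet_of_mxK m : cancel (@jet_of_mx m) (@jet_trunc R n m).
Proof.
move=> A; apply/matrixP => k j; rewrite !mxE /jet_of_mx -ltnS ltn_ord mxE.
by rewrite inord_val.
Qed.

Lemma jet_of_mx0 m (A : 'M[R]_(m.+1, n)) : jet_of_mx A 0 = row ord0 A.
Proof. by rewrite /jet_of_mx /=; congr row; apply/val_inj; rewrite /= inordK. Qed.

Lemma eq_jet_sym m J J' : eq_jet m J J' -> eq_jet m J' J.
Proof. by move=> JJ k km; rewrite JJ. Qed.

Lemma open_mx_dom m : open (mx_dom m).
Proof.
apply: open_comp => // A _.
move=> B /= /nbhs_ballP[e e0 eB]; apply/nbhs_ballP; exists e => //= A' [_ AA'].
by apply: eB; split=> // i j; rewrite !mxE; exact: AA'.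
Qed.
Arguments open_mx_dom : clear implicits.
Let oC m := open_cyl (open_mx_dom m).
Arguments oC : clear implicits.

Definition jet_order m (f : jet R n -> R) : Prop :=
  forall J J', Q (J 0%N) -> eq_jet m J J' -> f J = f J'.

(** The type [jet] carries no norm, so smoothness is tested on the matrices of the first [m + 1]
    components, through which [f] factors over [Q]. *)
Definition hjet m f : Prop := (forall h, jet_order m (f h)) /\
  smooth_on (cyl (mx_dom m)) (fun p => f p.2 (jet_of_mx p.1)).

(** A variation of the component of order 0 may leave [Q], but [Q] is open and the derivative at
    [t = 0] only sees small [t]. *)
Lemma jpartial_order m k j (f : jet R n -> R) :
  jet_order m f -> jet_order m (jpartial k j f).
Proof.
move=> fm J J' QJ JJ'; rewrite /jpartial !derive1E; apply: near_eq_derive.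
have : \forall t \near (0 : R), Q (J 0%N + t *: delta_mx 0 j).
  have ct : {for (0 : R), continuous (fun t : R => J 0%N + t *: delta_mx 0 j)}.
    by apply: cvgD; [exact: cvg_cst|apply: cvgZr_tmp; exact: cvg_id].
  apply: ct; rewrite scale0r addr0; exact: open_nbhs_nbhs.
apply: filterS => t Qt; apply: fm => [|l lm]; last by rewrite JJ'.
by case: eqP.
Qed.

Lemma jpartial_gt m k j (f : jet R n -> R) J :
  jet_order m f -> (m < k)%N -> Q (J 0%N) -> jpartial k j f J = 0.
Proof.
move=> fm mk QJ; rewrite /jpartial.
rewrite (_ : (fun t : R => _) = fun=> f J) ?derive1_cst//.
apply/funext => t; apply/esym/fm => // l lm.
by rewrite ltn_eqF// (leq_ltn_trans lm).
Qed.

Lemma total_deriv_order m (f : jet R n -> R) J : jet_order m f -> Q (J 0%N) ->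
  total_deriv f J = \sum_(k < m.+1) \sum_(j < n) J k.+1 0 j * jpartial k j f J.
Proof.
move=> fm QJ; rewrite /total_deriv.
rewrite -(big_mkord xpredT
  (fun k => \sum_(j < n) J k.+1 0 j * jpartial k j f J)).
rewrite -(fsbig_widen [set k | k \in index_iota 0 m.+1]) //=.
  by rewrite -fsbig_seq // iota_uniq.
move=> k [_ /=]; rewrite mem_index_iota /= => /negP; rewrite -leqNgt => mk.
by apply: big1 => j _; rewrite (jpartial_gt _ fm)// mulr0.
Qed.

Lemma derive_jet_of_mx m (k : 'I_m.+1) j f (A : 'M[R]_(m.+1, n)) h :
  'D_(delta_mx k j, 0) (fun p => f p.2 (jet_of_mx p.1)) (A, h) =
  jpartial k j (f h) (jet_of_mx A).
Proof.
rewrite /jpartial derive1E.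
have -> : (A, h) = (A, h) + 0 *: (delta_mx k j, 0) :> 'M[R]_(m.+1, n) * R.
  by rewrite scale0r addr0.
apply/esym/derive_slice => t; rewrite /= scaler0 addr0; congr (f h).
apply/funext => l; rewrite /jet_of_mx; case: eqP => [->|lk].
  rewrite -ltnS ltn_ord inord_val; apply/rowP => i; rewrite !mxE.
  by rewrite !eqxx.
case: ifP => // lm; apply/rowP => i; rewrite !mxE.
rewrite (_ : inord l == k = false) ?mulr0 ?addr0//.
by apply/negbTE/eqP => /(congr1 val); rewrite /= inordK.
Qed.

(** One index for each entry of a finite jet and one for h, so that composition with a jet-valued
    map becomes a case of [smooth_on_combine]. *)
Definition jet_index m : finType := ('I_m.+1 * 'I_n + 'I_1)%type.

Definition jet_basis m (i : jet_index m) : 'M[R]_(m.+1, n) * R :=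
  match i with inl kj => (delta_mx kj.1 kj.2, 0) | inr _ => (0, 1) end.

Definition jet_coords (V : Type) m (eta : V -> R) (Phi : V -> jet R n)
    (i : jet_index m) : V -> R :=
  match i with inl kj => fun x => Phi x kj.1 0 kj.2 | inr _ => eta end.

Lemma jet_combineE (V : Type) m (eta : V -> R) (Phi : V -> jet R n) x :
  \sum_i jet_coords eta Phi i x *: jet_basis i = (jet_trunc m (Phi x), eta x).
Proof.
rewrite big_sumType /= big_ord1 -(pair_bigA _ (fun (k : 'I_m.+1) (j : 'I_n) =>
  Phi x k 0 j *: ((delta_mx k j, 0) : 'M[R]_(m.+1, n) * R))) /=.
rewrite [X in _ + X](_ : _ = (0, eta x)); last first.
  by congr (_, _); rewrite /= ?scaler0// [_ *: _]mulr1.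
rewrite (_ : \sum_i _ = (jet_trunc m (Phi x), 0)).
  by congr (_, _); rewrite /= ?addr0 ?add0r.
rewrite [in RHS](matrix_sum_delta (jet_trunc m (Phi x))).
have fst_sum (A : Type) (r : seq A) (F : A -> 'M[R]_(m.+1, n)) :
    \sum_(i <- r) (F i, 0 : R) = (\sum_(i <- r) F i, 0).
  elim: r => [|a r IH]; first by rewrite !big_nil.
  by rewrite !big_cons IH; congr (_, _); rewrite /= addr0.
rewrite -fst_sum; apply: eq_bigr => k _; rewrite -fst_sum.
by apply: eq_bigr => j _; congr (_, _); rewrite /= ?scaler0// mxE.
Qed.

(** * Composition of functions on jets with jet-valued maps *)

Section Composition.
Variables (V : normedModType R) (U : set V).
Hypothesis oU : open U.
Variables (eta : V -> R) (Phi : V -> jet R n) (m : nat).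
Hypotheses (seta : smooth_on U eta)
  (sPhi : forall k j, (k <= m)%N -> smooth_on U (fun x => Phi x k 0 j))
  (QPhi : forall x, U x -> Q (Phi x 0%N)).
Let e := @jet_basis m.
Let c := @jet_coords V m eta Phi.

Lemma smooth_jet_coords (i : jet_index m) : smooth_on U (c i).
Proof. by case: i => [[k j]|i] //=; apply: sPhi; rewrite -ltnS. Qed.

Lemma jet_combine_dom x : U x -> cyl (mx_dom m) (\sum_i c i x *: e i).
Proof.
by move=> /QPhi; rewrite jet_combineE /cyl /= /mx_dom /= -jet_of_mx0 jet_truncK.
Qed.

Lemma hjet_combine f x : hjet m f -> U x ->
  f (eta x) (Phi x) = (fun p => f p.2 (jet_of_mx p.1)) (\sum_i c i x *: e i).
Proof.
move=> [fm _] Ux; rewrite jet_combineE; apply: fm; first exact: QPhi.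
exact/eq_jet_sym/jet_truncK.
Qed.

Lemma hjet_comp f : hjet m f -> smooth_on U (fun x => f (eta x) (Phi x)).
Proof.
move=> fm; apply: (smooth_on_ext oU (f := fun x =>
  (fun p => f p.2 (jet_of_mx p.1)) (\sum_i c i x *: e i))).
  by move=> x Ux; rewrite (hjet_combine fm).
exact: (smooth_on_combine oU smooth_jet_coords (proj2 fm) jet_combine_dom).
Qed.

(** The last term is the explicit dependence on h; it disappears in directions of constant [eta]. *)
Lemma hjet_chain f x v : hjet m f -> U x ->
  'D_v (fun x => f (eta x) (Phi x)) x =
  \sum_(k < m.+1) \sum_j 'D_v (fun x => Phi x k 0 j) x *
     jpartial k j (f (eta x)) (Phi x) +
  'D_v eta x * derive1 (fun h => f h (Phi x)) (eta x).
Proof.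
move=> fm Ux; rewrite (derive_ext v oU (fun x => @hjet_combine f x fm) Ux).
have [fo sf] := fm.
have dc i := smooth_on_differentiable (smooth_jet_coords i) Ux.
apply: etrans (derive_combine dc v
  (smooth_on_differentiable sf (jet_combine_dom Ux))) _.
have QJ : Q (jet_of_mx (jet_trunc m (Phi x)) 0%N) by rewrite jet_truncK//; exact: QPhi.
have JJ := @jet_truncK m (Phi x).
rewrite jet_combineE big_sumType /= big_ord1.
rewrite [X in _ + _ * X](Dh_slice (fun p => f p.2 (jet_of_mx p.1))) /=.
rewrite -(pair_bigA _ (fun (k : 'I_m.+1) (j : 'I_n) => 'D_v (fun x => Phi x k 0 j) x *
  'D_(delta_mx k j, 0) (fun p => f p.2 (jet_of_mx p.1)) (jet_trunc m (Phi x), eta x))) /=.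
congr (_ + _ * _).
  apply: eq_bigr => k _; apply: eq_bigr => j _; rewrite derive_jet_of_mx.
  by congr (_ * _); exact: (jpartial_order k j (fo _) QJ).
by congr (derive1 _ _); apply/funext => h; exact: fo.
Qed.

End Composition.

Section FlatJets.
Variables (V : normedModType R) (U : set V).
Hypothesis oU : open U.
Variable m : nat.

Definition smooth_jet (Phi : V * R -> jet R n) : Prop :=
  (forall k j, (k <= m)%N -> smooth_on (cyl U) (fun x => Phi x k 0 j)) /\
  (forall p, cyl U p -> Q (Phi p 0%N)).

Lemma hflat_jet_comp d f Phi : hjet m f -> smooth_jet Phi ->
  hflat (mx_dom m) d (fun p => f p.2 (jet_of_mx p.1)) ->
  hflat U d (fun p => f p.2 (Phi p)).
Proof.
move=> fm [sPhi QPhi] fd; apply: (hflat_ext oU (f := fun p =>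
  (fun q => f q.2 (jet_of_mx q.1)) (\sum_i jet_coords snd Phi i p *: jet_basis i))).
  by move=> p Cp; exact/esym/(hjet_combine snd QPhi fm Cp).
apply: (hflat_comp oU (open_mx_dom m) _ (proj2 fm) _ _ fd).
- exact: (smooth_jet_coords (smooth_snd oU) sPhi).
- exact: jet_combine_dom.
- by move=> p _; rewrite jet_combineE.
Qed.

Lemma hflat_jet_sub d f Phi Psi : hjet m f -> smooth_jet Phi -> smooth_jet Psi ->
  (forall k j, (k <= m)%N -> hflat U d (fun p => Phi p k 0 j - Psi p k 0 j)) ->
  hflat U d (fun p => f p.2 (Phi p) - f p.2 (Psi p)).
Proof.
move=> fm [sPhi QPhi] [sPsi QPsi] PP; apply: (hflat_ext oU (f := fun p =>
  (fun q => f q.2 (jet_of_mx q.1)) (\sum_i jet_coords snd Phi i p *: jet_basis i) -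
  (fun q => f q.2 (jet_of_mx q.1)) (\sum_i jet_coords snd Psi i p *: jet_basis i))).
  move=> p Cp; congr (_ - _); apply/esym.
    exact: (hjet_combine snd QPhi fm Cp).
  exact: (hjet_combine snd QPsi fm Cp).
apply: (hflat_comp_sub oU _ _ (proj2 fm)).
- exact: (smooth_jet_coords (smooth_snd oU) sPhi).
- exact: (smooth_jet_coords (smooth_snd oU) sPsi).
- exact: jet_combine_dom.
- exact: jet_combine_dom.
- case=> [[k j]|i] /=; first by apply: PP; rewrite -ltnS.
  by apply: (hflat_ext oU (f := fun=> 0)) => [p _|]; [rewrite subrr|exact: hflat_cst0].
Qed.

End FlatJets.

Lemma hjet_ext m f g : (forall h J, Q (J 0%N) -> f h J = g h J) -> hjet m f -> hjet m g.
Proof.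
move=> fg [fo sf]; split.
  move=> h J J' QJ JJ; rewrite -!fg//; first exact: fo.
  by rewrite -JJ.
apply: (smooth_on_ext (oC m) _ sf) => p Cp; rewrite fg//.
by rewrite jet_of_mx0.
Qed.

Let hjet_smooth m f : hjet m f -> smooth_on (cyl (mx_dom m)) (fun p => f p.2 (jet_of_mx p.1)).
Proof. by case. Qed.

Lemma hjet_cst m c : hjet m (fun _ _ => c).
Proof. by split=> //; exact: (smooth_on_cst (oC m)). Qed.

Lemma hjetD m f g : hjet m f -> hjet m g -> hjet m (fun h J => f h J + g h J).
Proof.
move=> [fo sf] [go sg]; split; last exact: (smooth_onD (oC m) sf sg).
by move=> h J J' QJ JJ; rewrite (fo h J J')// (go h J J').
Qed.

Lemma hjetM m f g : hjet m f -> hjet m g -> hjet m (fun h J => f h J * g h J).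
Proof.
move=> [fo sf] [go sg]; split; last exact: (smooth_onM (oC m) sf sg).
by move=> h J J' QJ JJ; rewrite (fo h J J')// (go h J J').
Qed.

Lemma hjetV m f : hjet m f -> (forall h J, Q (J 0%N) -> f h J != 0) ->
  hjet m (fun h J => (f h J)^-1).
Proof.
move=> [fo sf] f0; split.
  by move=> h J J' QJ JJ; rewrite (fo h J J').
by apply: (smooth_onV (oC m) sf) => p Cp; apply: f0; rewrite jet_of_mx0.
Qed.

Lemma hjet_sum m (I : Type) (r : seq I) (F : I -> R -> jet R n -> R) :
  (forall i, hjet m (F i)) -> hjet m (fun h J => \sum_(i <- r) F i h J).
Proof.
move=> sF; split.
  by move=> h J J' QJ JJ; apply: eq_bigr => i _; have [fo _] := sF i; exact: fo.
by apply: (smooth_on_sum (oC m)) => i; exact: hjet_smooth.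
Qed.

Lemma hjet_exph m k : hjet m (fun h _ => h ^+ k).
Proof. by split=> //; apply: (smooth_onX (oC m)); exact: (smooth_snd (open_mx_dom m)). Qed.

Lemma smooth_mx_entry m (k : 'I_m.+1) j : smooth_on (cyl (mx_dom m)) (fun p => p.1 k j).
Proof.
exact: (smooth_comp_fst (open_mx_dom m) (smooth_on_entry k j (open_mx_dom m))).
Qed.

Lemma hjet_coord m k j : (k <= m)%N -> hjet m (fun _ J => J k 0 j).
Proof.
move=> km; split; first by move=> h J J' QJ JJ; rewrite JJ.
rewrite /jet_of_mx km.
apply: smooth_on_ext (oC m) _ (smooth_mx_entry (inord k) j) => p _.
by rewrite mxE.
Qed.

Lemma hjet_jpartial m k j f : hjet m f -> hjet m (fun h => jpartial k j (f h)).
Proof.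
move=> [fo sf]; split; first by move=> h; exact: jpartial_order.
have [km|km] := leqP k m.
  apply: smooth_on_ext (oC m) _ (smooth_on_derive (delta_mx (inord k) j, 0) sf).
  by move=> [A h] _; rewrite derive_jet_of_mx inordK.
apply: smooth_on_ext (oC m) _ (smooth_on_cst (oC m) 0) => p Cp.
by rewrite (jpartial_gt _ (fo _))// jet_of_mx0.
Qed.

Lemma hjet_subst m m' f (Psi : R -> jet R n -> jet R n) : hjet m f ->
  (forall k j, (k <= m)%N -> hjet m' (fun h J => Psi h J k 0 j)) ->
  (forall h J, Q (J 0%N) -> Q (Psi h J 0%N)) ->
  hjet m' (fun h J => f h (Psi h J)).
Proof.
move=> fm sPsi QPsi; split.
  have [fo _] := fm; move=> h J J' QJ JJ; apply: fo; first exact: QPsi.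
  by move=> k km; apply/rowP => j; have [po _] := sPsi k j km; exact: po.
apply: (hjet_comp (oC m') (smooth_snd (open_mx_dom m'))
  (Phi := fun p => Psi p.2 (jet_of_mx p.1)) _ _ fm).
  by move=> k j km; exact: (hjet_smooth (sPsi k j km)).
by move=> p Cp; apply: QPsi; rewrite jet_of_mx0.
Qed.

Lemma hjet_le m m' f : (m <= m')%N -> hjet m f -> hjet m' f.
Proof.
move=> mm fm; apply: (hjet_subst (Psi := fun _ J => J) fm) => // k j km.
exact/hjet_coord/(leq_trans km).
Qed.

Lemma hjet_total m f : hjet m f -> hjet m.+1 (fun h => total_deriv (f h)).
Proof.
move=> fm; have [fo _] := fm.
apply: (@hjet_ext _ (fun h J =>
    \sum_(k < m.+1) \sum_(j < n) J k.+1 0 j * jpartial k j (f h) J)).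
  by move=> h J QJ; rewrite (total_deriv_order (fo h)).
apply: hjet_sum => k; apply: hjet_sum => j; apply: hjetM.
  exact: hjet_coord.
exact/(@hjet_le m)/hjet_jpartial.
Qed.

Lemma hjet_iter_total m f k : hjet m f ->
  hjet (m + k) (fun h => iter k (@total_deriv R n) (f h)).
Proof.
by move=> fm; elim: k => [|k IH]; rewrite ?addn0// addnS; exact: hjet_total.
Qed.

Lemma hjet_coef m k f : hjet m f ->
  hjet m (fun _ J => (k`!%:R)^-1 * derive1n k (fun h => f h J) 0).
Proof.
move=> [fo sf]; split.
  move=> _ J J' QJ JJ; rewrite (_ : (fun h => f h J) = (fun h => f h J'))//.
  by apply/funext => h; exact: fo.
apply: smooth_on_ext (oC m) _ (smooth_comp_fst (open_mx_dom m)
  (smooth_hcoef (open_mx_dom m) k sf)) => p _.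
by rewrite /hcoef iter_Dh_slice.
Qed.

Lemma hjet_scale_exph m k f : hjet m f -> hjet m (fun h J => h ^+ k * f h J).
Proof. by move=> fm; apply: hjetM => //; exact: hjet_exph. Qed.

End JetFunctions.
Arguments mx_dom {R n} Q m.
Arguments open_mx_dom {R n Q} oQ m.

(** * The repeated substitution *)

Lemma hsum_entry (R : realType) (X : Type) p q N (c : nat -> X -> 'M[R]_(p, q)) h x i j :
  hsum N c h x i j = \sum_(k < N.+1) h ^+ k * c k x i j.
Proof. by rewrite /hsum summxE; apply: eq_bigr => k _; rewrite !mxE. Qed.

Lemma hsum0 (R : realType) (X : Type) (V : lmodType R) N (c : nat -> X -> V) x :
  hsum N c 0 x = c 0%N x.
Proof.
rewrite /hsum big_ord_recl expr0 scale1r big1 ?addr0// => k _.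
by rewrite expr0n /= scale0r.
Qed.

Section Determinants.
Variables (R : realType) (n : nat) (Q : set 'rV[R]_n).
Hypothesis oQ : open Q.

Lemma hjet_det m d (A : R -> jet R n -> 'M[R]_d) :
  (forall i j, hjet Q m (fun h J => A h J i j)) -> hjet Q m (fun h J => \det (A h J)).
Proof.
move=> sA; split=> [h J J' QJ JJ|].
  congr (\det _); apply/matrixP => i j; have [order_eq _] := sA i j.
  exact: (order_eq h).
apply: (smooth_on_det (open_cyl (open_mx_dom oQ m))
  (A := fun p => A p.2 (jet_of_mx p.1))) => i j.
by case: (sA i j).
Qed.

Lemma hjet_invmx m d (A : R -> jet R n -> 'M[R]_d) :
  (forall i j, hjet Q m (fun h J => A h J i j)) ->
  (forall h J, Q (J 0%N) -> A h J \in unitmx) ->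
  forall i j, hjet Q m (fun h J => invmx (A h J) i j).
Proof.
move=> sA uA i j; apply: (hjet_ext oQ (f := fun h J =>
  (\det (A h J))^-1 * ((-1) ^+ (j + i) * \det (row' j (col' i (A h J)))))).
  by move=> h J QJ; rewrite /invmx uA// !mxE.
apply: (hjetM oQ).
  apply: (hjetV oQ); first exact: hjet_det.
  by move=> h J /uA - /(_ h); rewrite unitmxE unitfE.
apply: (hjetM oQ); first exact: (hjet_cst oQ).
apply: hjet_det => k l.
by apply: (hjet_ext oQ) (sA (lift j k) (lift i l)) => h J _; rewrite !mxE.
Qed.

End Determinants.

Section Reduction.
Variables (R : realType) (n : nat) (Q : set 'rV[R]_n) (M : nat -> nat).
Variables (L : lagrangian R n M).
Hypotheses (oQ : open Q) (sL : lag_smooth Q L).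
Hypothesis rkL : forall J : jet R n, Q (J 0%N) -> \rank (jhessian 1 (lag L 0) J) = n.
Variable N : nat.
Implicit Types (J : jet R n) (r : nat -> jet R n -> 'rV[R]_n).

Lemma hjet_lag i : hjet Q (lag_order M i) (fun _ => lag L i).
Proof.
split=> [_ J J' _ JJ|]; first exact: lag_eq.
have oD := open_mx_dom oQ (lag_order M i).
apply: (smooth_on_ext (open_cyl oD) _ (smooth_comp_fst oD (@sL i))) => p _.
by rewrite /lag jet_of_mxK.
Qed.

Lemma hjet_euler_lagrange i j : hjet Q (lag_order M i + lag_order M i)
  (fun _ J => euler_lagrange L i J 0 j).
Proof.
apply: (hjet_ext oQ (f := fun _ J => \sum_(m < (lag_order M i).+1)
    (-1) ^+ m * iter m (@total_deriv R n) (jpartial m j (lag L i)) J)).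
  by move=> h J _; rewrite mxE.
apply: (hjet_sum oQ) => m; apply: (hjetM oQ); first exact: (hjet_cst oQ).
apply: (@hjet_le _ _ _ oQ (lag_order M i + m)).
  by rewrite leq_add2l -ltnS.
exact/(hjet_iter_total oQ m (f := fun _ => jpartial m j (lag L i)))/(hjet_jpartial oQ)/hjet_lag.
Qed.

Lemma hessian_unit J : Q (J 0%N) -> jhessian 1 (lag L 0) J \in unitmx.
Proof. by move=> /rkL rk; rewrite -row_full_unit /row_full rk. Qed.

Lemma hjet_hessian i j : hjet Q 1 (fun _ J => jhessian 1 (lag L 0) J i j).
Proof.
apply: (hjet_ext oQ (f := fun _ => jpartial 1 i (jpartial 1 j (lag L 0)))).
  by move=> h J _; rewrite mxE.
apply: (hjet_jpartial oQ 1 i (f := fun _ => jpartial 1 j (lag L 0))).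
exact: (hjet_jpartial oQ 1 j (hjet_lag 0)).
Qed.

Lemma jet_to1K J : eq_jet 1 (jet_of1 (jet_to1 J)) J.
Proof. by case=> [|[|]] // _; rewrite /jet_of1 /jet_to1 (row_mxKl, row_mxKr). Qed.

Lemma hjet_jet_of1 k j : hjet Q 1 (fun _ J => jet_of1 (jet_to1 J) k 0 j).
Proof.
case: (leqP k 1) => k1.
  by apply: (hjet_ext oQ) (hjet_coord oQ j k1) => h J _; rewrite jet_to1K.
apply: (hjet_ext oQ) (hjet_cst oQ 1 0) => h J _.
by case: k k1 => [|[|]]//= k _; rewrite mxE.
Qed.

(** The map [Psi] covers both branches of [ode_rhs]: truncation to the 1-jet for the
    h^0-coefficient, the identity otherwise. *)
Lemma hjet_ode_rhs_gen m i j (Psi : jet R n -> jet R n) : (1 <= m)%N ->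
  (forall j, hjet Q m (fun _ J => euler_lagrange L i (Psi J) 0 j)) ->
  hjet Q m (fun _ J => (euler_lagrange L i (Psi J) *m invmx (jhessian 1 (lag L 0) J)) 0 j).
Proof.
move=> m1 sE; apply: (hjet_ext oQ (f := fun _ J => \sum_k
    euler_lagrange L i (Psi J) 0 k * invmx (jhessian 1 (lag L 0) J) k j)).
  by move=> h J _; rewrite [RHS]mxE.
apply: (hjet_sum oQ) => k; apply: (hjetM oQ); first exact: sE.
apply: (hjet_le oQ m1); apply: (hjet_invmx oQ (A := fun _ => jhessian 1 (lag L 0))).
  by move=> i' j'; exact: hjet_hessian.
by move=> h J; exact: hessian_unit.
Qed.

(** Starts the termination argument, and later provides the gain of one power of h in each pass. *)
Lemma hjet_ode_rhs0 j : hjet Q 1 (fun _ J => ode_rhs L 0 J 0 j).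
Proof.
apply: (hjet_ode_rhs_gen j (Psi := fun J => jet_of1 (jet_to1 J))) => // k.
apply: (hjet_subst oQ (Psi := fun _ J => jet_of1 (jet_to1 J)) (hjet_euler_lagrange 0 k)).
  by move=> *; exact: hjet_jet_of1.
by move=> h J; rewrite jet_to1K.
Qed.

(** A crude common bound: Euler-Lagrange expressions reach twice the order of the Lagrangian, and
    the successor leaves room for the 1-jet seen by the inverse Hessian even when [M i] is 0. *)
Definition ode_order : nat := \max_(i < N.+1) (lag_order M i + lag_order M i).+1.

Lemma hjet_ode_rhs i j : (i <= N)%N -> hjet Q ode_order (fun _ J => ode_rhs L i J 0 j).
Proof.
move=> iN; have le : ((lag_order M i + lag_order M i).+1 <= ode_order)%N.
  exact: (@leq_bigmax _ (fun i : 'I_N.+1 => (lag_order M i + lag_order M i).+1)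
    (Ordinal (iN : (i < N.+1)%N))).
apply: (hjet_le oQ le); case: i {iN le} => [|i].
  by apply: (hjet_le oQ) (hjet_ode_rhs0 j).
apply: (hjet_ode_rhs_gen j (Psi := id)) => // k.
exact: (hjet_le oQ) (hjet_euler_lagrange i.+1 k).
Qed.

Definition hjet_family l r : Prop :=
  forall i j, (i <= N)%N -> hjet Q l (fun _ J => r i J 0 j).

Lemma hjet_hsum l r j : hjet_family l r -> hjet Q l (fun h J => hsum N r h J 0 j).
Proof.
move=> rl; apply: (hjet_ext oQ (f := fun h J => \sum_(i < N.+1) h ^+ i * r i J 0 j)).
  by move=> h J _; rewrite hsum_entry.
by apply: (hjet_sum oQ) => i; apply/(hjet_scale_exph oQ)/rl; rewrite -ltnS.
Qed.

Lemma subst_jet_lt2 h J k : (k < 2)%N -> subst_jet L N h J k = J k.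
Proof. by rewrite /subst_jet => ->. Qed.

Lemma subst_jet_ge2 h J k j : (2 <= k)%N -> subst_jet L N h J k 0 j =
  iter (k - 2) (@total_deriv R n) (fun J' => hsum N (ode_rhs L) h J' 0 j) J.
Proof. by rewrite leqNgt => /negbTE k2; rewrite /subst_jet k2 mxE. Qed.

Lemma hjet_subst_jet l k j : (k <= l)%N ->
  hjet Q (ode_order + l) (fun h J => subst_jet L N h J k 0 j).
Proof.
move=> kl; case: (ltnP k 2) => k2.
  apply: (hjet_ext oQ) (hjet_coord oQ j (leq_trans kl (leq_addl _ _))) => h J _.
  by rewrite subst_jet_lt2.
apply: (hjet_ext oQ (f := fun h J => iter (k - 2) (@total_deriv R n)
    (fun J' => hsum N (ode_rhs L) h J' 0 j) J)).
  by move=> h J _; rewrite subst_jet_ge2.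
apply: (@hjet_le _ _ _ oQ (ode_order + (k - 2))).
  by rewrite leq_add2l (leq_trans (leq_subr _ _)).
apply: (hjet_iter_total oQ (k - 2) (f := fun h J' => hsum N (ode_rhs L) h J' 0 j)).
by apply: hjet_hsum => i i' iN; exact: hjet_ode_rhs.
Qed.

Lemma hjet_term_subst l (f : jet R n -> R) : hjet Q l (fun _ => f) ->
  hjet Q (ode_order + l) (fun h J => f (subst_jet L N h J)).
Proof.
move=> fl; apply: (hjet_subst oQ (Psi := subst_jet L N) fl).
  by move=> k j kl; exact: hjet_subst_jet.
by move=> h J; rewrite subst_jet_lt2.
Qed.

Lemma hjet_hsum_subst l r j : hjet_family l r ->
  hjet Q (ode_order + l) (fun h J => hsum N r h (subst_jet L N h J) 0 j).
Proof.
move=> rl; apply: (hjet_subst oQ (Psi := subst_jet L N) (hjet_hsum j rl)).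
  by move=> k i kl; exact: hjet_subst_jet.
by move=> h J; rewrite subst_jet_lt2.
Qed.

Lemma hjet_substitute l r k j : hjet_family l r ->
  hjet Q (ode_order + l) (fun _ J => substitute L N r k J 0 j).
Proof.
move=> rl; apply: (hjet_ext oQ) (hjet_coef oQ k (hjet_hsum_subst j rl)) => h J _.
by rewrite mxE.
Qed.

Lemma hjet_iter_substitute s : exists l, hjet_family l (iter s (substitute L N) (ode_rhs L)).
Proof.
elim: s => [|s [l IH]] /=.
  by exists ode_order => i j; exact: hjet_ode_rhs.
by exists (ode_order + l)%N => i j _; exact: hjet_substitute.
Qed.

(* As long as the coefficients below h^k do not see the substituted derivatives,
   the h^k-coefficient only sees their values at h = 0. *)
Lemma substitute_lead l r k J j : hjet_family l r ->
  (forall i j, (i < k)%N -> hjet Q 1 (fun _ J => r i J 0 j)) ->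
  (k <= N)%N -> Q (J 0%N) -> substitute L N r k J 0 j = r k (subst_jet L N 0 J) 0 j.
Proof.
move=> rl r1 kN QJ; pose m := (ode_order + l)%N.
pose A := jet_trunc m J.
have DA : mx_dom Q m A by rewrite /mx_dom /= -jet_of_mx0 jet_truncK.
have oD : open (mx_dom Q m) by exact: open_mx_dom.
have oC := open_cyl oD.
pose G i (p : 'M[R]_(m.+1, n) * R) := r i (subst_jet L N p.2 (jet_of_mx p.1)) 0 j.
have sG i : (i <= N)%N -> smooth_on (cyl (mx_dom Q m)) (G i).
  by move=> iN; have [] := hjet_term_subst (rl i j iN).
pose c i B := G i (B, 0).
have sc i : (i <= N)%N -> smooth_on (mx_dom Q m) (c i).
  by move=> /sG; exact: smooth_slice.
have Go i h : (i <= N)%N -> G i (A, h) = r i (subst_jet L N h J) 0 j.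
  move=> iN; have [+ _] := hjet_term_subst (rl i j iN); apply; last exact: jet_truncK.
  by rewrite jet_truncK.
pose F (p : 'M[R]_(m.+1, n) * R) := \sum_(i < N.+1) p.2 ^+ i * G i p.
have FE : (fun h => hsum N r h (subst_jet L N h J) 0 j) = fun h => F (A, h).
  apply/funext => h; rewrite hsum_entry; apply: eq_bigr => i _.
  by rewrite Go// -ltnS.
rewrite mxE FE -iter_Dh_slice -/(hcoef k F A) -(Go k 0 kN) -/(c k A).
rewrite -(hcoef_hpoly oD sc DA kN); apply: (@hcoef_eq _ _ _ oD k k) => //.
- by apply: (smooth_on_sum oC) => i; apply: (smooth_onM oC);
    [exact/(smooth_onX oC)/(smooth_snd oD)|apply: sG; rewrite -ltnS].
- exact: (smooth_hpoly oD).
apply: (hflat_ext oD (f := fun p => \sum_(i < N.+1) p.2 ^+ i * (G i p - c i p.1))).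
  by move=> p _; rewrite -sumrB; apply: eq_bigr => i _; rewrite mulrBr.
have sGc (i : 'I_N.+1) : smooth_on (cyl (mx_dom Q m)) (fun p => G i p - c i p.1).
  have iN : (i <= N)%N by rewrite -ltnS.
  by apply: (smooth_onB oC); [exact: sG|exact/(smooth_comp_fst oD)/sc].
apply: (hflat_sum oD) => i.
  by apply: (smooth_onM oC) => //; exact/(smooth_onX oC)/(smooth_snd oD).
(* Below [k] the substitution is invisible to [r i], and the term is zero. From [k] on, [G i - c i]
   vanishes at h = 0, which raises the order [i] of the factor to [i + 1], more than [k]. *)
have [ik|ki] := ltnP i k.
  apply: (hflat_ext oD (f := fun=> 0)); last exact: hflat_cst0.
  move=> p Dp; have [+ _] := r1 i j ik => /(_ 0) r1i.
  rewrite /c /G /= (r1i _ (jet_of_mx p.1)) ?subst_jet_lt2 ?jet_of_mx0//; last first.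
    by move=> q q1; rewrite subst_jet_lt2.
  rewrite (r1i (subst_jet _ _ _ _) (jet_of_mx p.1)) ?subst_jet_lt2 ?jet_of_mx0//.
    by rewrite subrr mulr0.
  by move=> q q1; rewrite subst_jet_lt2.
apply: (@hflat_le _ _ _ (i + 1)); first by rewrite addn1 ltnS.
apply: (hflat_expM oD) => //; apply/hflatS; split => // B DB.
by rewrite /c /= subrr.
Qed.

(** At h = 0 the derivative of order [q >= 2] is replaced by the total derivative of order [q - 2]
    of a function on the 1-jet space, which has order [q - 1]. So one round lowers the order of the
    leading coefficient by one. *)
Lemma substitute_order l r k m : hjet_family l r ->
  (forall i j, (i < k)%N -> hjet Q 1 (fun _ J => r i J 0 j)) ->
  (k <= N)%N -> (1 <= m)%N -> (forall j, hjet Q m.+1 (fun _ J => r k J 0 j)) ->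
  forall j, hjet Q m (fun _ J => substitute L N r k J 0 j).
Proof.
move=> rl r1 kN m1 rk j.
apply: (hjet_ext oQ (f := fun _ J => r k (subst_jet L N 0 J) 0 j)).
  by move=> h J QJ; rewrite (substitute_lead _ rl).
apply: (hjet_subst oQ (Psi := fun _ => subst_jet L N 0) (rk j)).
  move=> q i qm; have [q2|q2] := ltnP q 2.
    apply: (hjet_ext oQ) (hjet_coord oQ i (leq_trans (q2 : (q <= 1)%N) m1)) => h J _.
    by rewrite subst_jet_lt2.
  apply: (hjet_ext oQ (f := fun h J => iter (q - 2) (@total_deriv R n)
      (fun J' => ode_rhs L 0 J' 0 i) J)).
    move=> h J _; rewrite subst_jet_ge2//; congr (iter _ _ _ _).
    by apply/funext => J'; rewrite hsum0.
  apply: (@hjet_le _ _ _ oQ (1 + (q - 2))).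
    by case: q qm q2 => [|[|q]] // qm _; rewrite !subSS subn0 add1n.
  exact: (hjet_iter_total oQ (q - 2) (hjet_ode_rhs0 i)).
by move=> h J; rewrite subst_jet_lt2.
Qed.

Lemma substitute_order1 l r k : hjet_family l r ->
  (forall i j, (i <= k)%N -> hjet Q 1 (fun _ J => r i J 0 j)) -> (k <= N)%N ->
  forall i j, (i <= k)%N -> hjet Q 1 (fun _ J => substitute L N r i J 0 j).
Proof.
move=> rl r1 kN i j ik; apply: (substitute_order rl) => //.
- by move=> i' j' i'i; apply/r1/ltnW/(leq_trans i'i).
- exact: leq_trans kN.
- by move=> j'; apply: (hjet_le oQ) (r1 i j' ik).
Qed.

(** The outer induction is on the power of h, the inner one on the order of its coefficient: once
    all lower coefficients live on the 1-jet space they stay there, and each further round lowers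
    the next one by one order. *)
Lemma substitution_terminates k : (k <= N)%N -> exists s, forall i j, (i <= k)%N ->
  hjet Q 1 (fun _ J => iter s (substitute L N) (ode_rhs L) i J 0 j).
Proof.
elim: k => [_|k IH kN].
  by exists 0%N => i j; rewrite leqn0 => /eqP ->; exact: hjet_ode_rhs0.
have [s sk] := IH (ltnW kN).
have [l /(_ k.+1 _ kN) rk] := hjet_iter_substitute s.
(* The order bound is written [l.+1] so that the inner induction ends at order 1. *)
have {rk} := fun j => hjet_le oQ (leqnSn l) (rk j).
elim: l s sk => [|l IHl] s sk rk.
  by exists s => i j; rewrite leq_eqVlt => /orP[/eqP ->|ik]; [exact: rk|exact: sk].
have [l' rl] := hjet_iter_substitute s.
apply: (IHl s.+1) => [i j ik|j] /=.
  exact: (substitute_order1 rl sk (ltnW kN)).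
exact: (substitute_order (k := k.+1) rl sk kN (ltn0Sn l) rk).
Qed.

Lemma reduced_coefs_exist :
  exists a : nat -> 'rV[R]_(n + n) -> 'rV[R]_n, reduced_coefs L Q N a.
Proof.
have [s sN] := substitution_terminates (leqnn N).
exists (fun k z => iter s (substitute L N) (ode_rhs L) k (jet_of1 z)), s => k J kN QJ.
apply/rowP => j; have [+ _] := sN k j kN => /(_ 0); apply => //.
exact/eq_jet_sym/jet_to1K.
Qed.

End Reduction.

(** * The flow of the reduced equation *)

Section ReducedFlow.
Variables (R : realType) (n : nat) (Q : set 'rV[R]_n) (M : nat -> nat).
Variables (L : lagrangian R n M).
Hypotheses (oQ : open Q) (sL : lag_smooth Q L).
Hypothesis rkL : forall J : jet R n, Q (J 0%N) -> \rank (jhessian 1 (lag L 0) J) = n.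
Variables (N : nat) (a : nat -> 'rV[R]_(n + n) -> 'rV[R]_n).
Hypothesis red : reduced_coefs L Q N a.
Local Notation Z := 'rV[R]_(n + n).
Local Notation U := (Jet1 Q).
Local Notation C := (cyl U).
Implicit Types (f g : Z * R -> R) (z : Z) (p : Z * R) (j : 'I_n).

Lemma open_Jet1 : open U.
Proof. by apply: open_comp => // z _; exact: continuous_lsubmx. Qed.
Let oU := open_Jet1.
Let oC := open_cyl oU.

Lemma jet_of1K z : jet_to1 (jet_of1 z) = z.
Proof. by rewrite /jet_to1 /= hsubmxK. Qed.

Lemma smooth_jet_of1 k j : smooth_on U (fun z => jet_of1 z k 0 j).
Proof.
case: k => [|[|k]] /=.
- apply: smooth_on_ext oU _ (smooth_on_entry 0 (lshift n j) oU) => z _.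
  by rewrite mxE.
- apply: smooth_on_ext oU _ (smooth_on_entry 0 (rshift n j) oU) => z _.
  by rewrite mxE.
- apply: smooth_on_ext oU _ (smooth_on_cst oU 0) => z _.
  by rewrite mxE.
Qed.

Lemma smooth_reduced_coefs k j : (k <= N)%N -> smooth_on U (fun z => a k z 0 j).
Proof.
move=> kN; have [s sa] := red; have [l ls] := hjet_iter_substitute oQ sL rkL N s.
apply: (smooth_on_ext oU (f := fun z =>
    (fun _ J => iter s (substitute L N) (ode_rhs L) k J 0 j) (0 : R) (jet_of1 z))).
  by move=> z Uz; rewrite sa// jet_of1K.
have sJ q i : (q <= l)%N -> smooth_on U (fun z => jet_of1 z q 0 i).
  by move=> _; exact: smooth_jet_of1.
have QJ z : U z -> Q (jet_of1 z 0%N) by [].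
exact: (hjet_comp oU (smooth_on_cst oU 0) sJ QJ (ls k j kN)).
Qed.

Definition acceleration j p : R := hsum N a p.2 p.1 0 j.

Lemma smooth_acceleration j : smooth_on C (acceleration j).
Proof.
apply: (smooth_on_ext oC (f := fun p => \sum_(k < N.+1) p.2 ^+ k * a k p.1 0 j)).
  by move=> p _; rewrite /acceleration hsum_entry.
apply: (smooth_hpoly oU (c := fun k z => a k z 0 j)) => k kN.
exact: smooth_reduced_coefs.
Qed.

Definition flow_field p : Z := second_order_field N a p.2 p.1.

(** The zero h-component makes h a parameter of the flow; hence derivatives along the flow cost no
    order in h. *)
Definition XA f p : R := 'D_((flow_field p, 0)) f p.

Lemma flow_field_l p j : flow_field p 0 (lshift n j) = p.1 0 (rshift n j).
Proof. by rewrite /flow_field /second_order_field row_mxEl mxE. Qed.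

Lemma flow_field_r p j : flow_field p 0 (rshift n j) = acceleration j p.
Proof. by rewrite /flow_field /second_order_field row_mxEr. Qed.

Lemma smooth_flow_field b : smooth_on C (fun p => flow_field p 0 b).
Proof.
have [j ->|j ->] := split_ordP b.
  apply: smooth_on_ext oC _ (smooth_comp_fst oU (smooth_on_entry 0 (rshift n j) oU)) => p _.
  by rewrite flow_field_l.
apply: smooth_on_ext oC _ (smooth_acceleration j) => p _.
by rewrite flow_field_r.
Qed.

Definition Dz (b : 'I_(n + n)) f : Z * R -> R := 'D_((delta_mx 0 b, 0) : Z * R) f.

Lemma smooth_Dz b f : smooth_on C f -> smooth_on C (Dz b f).
Proof. exact: smooth_on_derive. Qed.

Lemma XA_Dz f p : smooth_on C f -> C p ->
  XA f p = \sum_b flow_field p 0 b * Dz b f p.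
Proof.
move=> sf Cp; have df := smooth_on_differentiable sf Cp.
rewrite /XA deriveE//.
have -> : (flow_field p, 0) =
    \sum_b flow_field p 0 b *: ((delta_mx 0 b, 0) : Z * R).
  have fst_sum (r : seq 'I_(n + n)) (F : 'I_(n + n) -> Z) :
      \sum_(i <- r) (F i, 0 : R) = (\sum_(i <- r) F i, 0).
    elim: r => [|b r IH]; first by rewrite !big_nil.
    by rewrite !big_cons IH; congr (_, _); rewrite /= addr0.
  rewrite [in LHS](row_sum_delta (flow_field p)) -fst_sum; apply: eq_bigr => b _.
  by congr (_, _); rewrite /= scaler0.
rewrite linear_sum; apply: eq_bigr => b _.
by rewrite linearZ /= /Dz deriveE.
Qed.

Lemma XA_ext f g : (forall p, C p -> f p = g p) -> forall p, C p -> XA f p = XA g p.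
Proof. by move=> fg p Cp; exact: (derive_ext _ oC fg Cp). Qed.

Lemma smooth_XA f : smooth_on C f -> smooth_on C (XA f).
Proof.
move=> sf; apply: (smooth_on_ext oC (f := fun p =>
    \sum_b flow_field p 0 b * Dz b f p)).
  by move=> p Cp; rewrite XA_Dz.
apply: (smooth_on_sum oC) => b; apply: (smooth_onM oC).
  exact: smooth_flow_field.
exact: smooth_Dz.
Qed.

Lemma hflat_XA k f : smooth_on C f -> hflat U k f -> hflat U k (XA f).
Proof.
move=> sf ff; apply: (hflat_ext oU (f := fun p =>
    \sum_b flow_field p 0 b * Dz b f p)).
  by move=> p Cp; rewrite XA_Dz.
apply: (hflat_sum oU) => b.
  by apply: (smooth_onM oC); [exact: smooth_flow_field|exact: smooth_Dz].
apply: (hflatMr oU); [exact: smooth_flow_field|exact: smooth_Dz|].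
exact: (hflat_derive_fst oU).
Qed.

Lemma smooth_iter_XA k f : smooth_on C f -> smooth_on C (iter k XA f).
Proof. by move=> sf; elim: k => //= k; exact: smooth_XA. Qed.

Lemma iter_XAB k f g p : smooth_on C f -> smooth_on C g -> C p ->
  iter k XA (fun p => f p - g p) p = iter k XA f p - iter k XA g p.
Proof.
move=> sf sg; elim: k p => //= k IH p Cp.
by rewrite (XA_ext IH Cp) /XA (smooth_deriveB _ Cp)//; exact: smooth_iter_XA.
Qed.

Lemma hflat_iter_XA i k f : smooth_on C f -> hflat U k f -> hflat U k (iter i XA f).
Proof. by move=> sf ff; elim: i => //= i; apply: hflat_XA; exact: smooth_iter_XA. Qed.

Definition flow_coord k j : Z * R -> R :=
  match k with
  | 0 => fun p => p.1 0 (lshift n j)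
  | 1 => fun p => p.1 0 (rshift n j)
  | k.+2 => iter k XA (acceleration j)
  end.

(** The embedding [sigma]. *)
Definition flow_jet p : jet R n := fun k => \row_j flow_coord k j p.

Lemma smooth_flow_coord k j : smooth_on C (flow_coord k j).
Proof.
case: k => [|[|k]] /=; last exact/smooth_iter_XA/smooth_acceleration.
  exact: (smooth_comp_fst oU (smooth_on_entry 0 (lshift n j) oU)).
exact: (smooth_comp_fst oU (smooth_on_entry 0 (rshift n j) oU)).
Qed.

Lemma Dz_coord b b' p : Dz b (fun p => p.1 0 b') p = (b == b')%:R.
Proof.
rewrite /Dz (derive_comp_fst (fun z : Z => z 0 b')) /=.
rewrite deriveE; last exact: differentiable_coord.
have @F : {linear Z -> R}.
  by exists (fun N : 'M[R]_(_, _) => N 0 b'); do 2![eexists]; do ?[constructor];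
     rewrite ?mxE// => ? *; rewrite ?mxE//; move=> ?; rewrite !mxE.
rewrite (_ : (fun _ => _) = F)// diff_lin; last exact: coord_continuous.
by rewrite /F /= mxE eqxx eq_sym.
Qed.

Lemma XA_coord b p : C p -> XA (fun p => p.1 0 b) p = flow_field p 0 b.
Proof.
move=> Cp; rewrite XA_Dz//; last exact: (smooth_comp_fst oU (smooth_on_entry 0 b oU)).
rewrite (bigD1 b)//= Dz_coord eqxx mulr1 big1 ?addr0// => b' /negbTE b'b.
by rewrite Dz_coord b'b mulr0.
Qed.

Lemma XA_flow_coord k j p : C p -> XA (flow_coord k j) p = flow_coord k.+1 j p.
Proof.
case: k => [|[|k]] Cp //=; rewrite XA_coord//; first exact: flow_field_l.
exact: flow_field_r.
Qed.

Lemma flow_jet_smooth m : smooth_jet Q U m flow_jet.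
Proof.
split=> [k j _|p Cp].
  by apply: smooth_on_ext oC _ (smooth_flow_coord k j) => p _; rewrite mxE.
rewrite (_ : flow_jet p 0%N = lsubmx p.1)//.
by apply/rowP => j; rewrite !mxE.
Qed.

Lemma smooth_on_flow m (f : R -> jet R n -> R) : hjet Q m f ->
  smooth_on C (fun p => f p.2 (flow_jet p)).
Proof.
have [sF QF] := flow_jet_smooth m.
exact: (hjet_comp oC (smooth_snd oU) sF QF).
Qed.

Lemma XA_flow_jet m (f : R -> jet R n -> R) p : hjet Q m f -> C p ->
  XA (fun p => f p.2 (flow_jet p)) p = total_deriv (f p.2) (flow_jet p).
Proof.
move=> fm Cp; have [sF QF] := flow_jet_smooth m.
rewrite /XA (hjet_chain oQ oC (smooth_snd oU) sF QF _ fm Cp) derive_comp_snd mul0r addr0.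
rewrite (total_deriv_order (proj1 fm _) (QF _ Cp)).
apply: eq_bigr => k _; apply: eq_bigr => j _; congr (_ * _).
rewrite [RHS]mxE -XA_flow_coord//; apply: (derive_ext _ oC) => // p' _.
by rewrite mxE.
Qed.

Lemma iter_XA_flow_jet m i (f : R -> jet R n -> R) p : hjet Q m f -> C p ->
  iter i XA (fun p => f p.2 (flow_jet p)) p =
  iter i (@total_deriv R n) (f p.2) (flow_jet p).
Proof.
move=> fm; elim: i p => //= i IH p Cp.
rewrite (XA_ext IH Cp).
exact: (XA_flow_jet (f := fun h => iter i (@total_deriv R n) (f h))
  (hjet_iter_total oQ i fm)).
Qed.

Lemma flow_jet1 p J : C p -> J = flow_jet p -> jet_to1 J = p.1.
Proof.
move=> _ ->; rewrite -[RHS]hsubmxK /jet_to1.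
by congr row_mx; apply/rowP => j; rewrite !mxE.
Qed.

Definition flow_rhs (r : nat -> jet R n -> 'rV[R]_n) j p : R :=
  hsum N r p.2 (flow_jet p) 0 j.

Lemma smooth_flow_rhs l r j : hjet_family Q N l r -> smooth_on C (flow_rhs r j).
Proof. by move=> rl; exact: (smooth_on_flow (hjet_hsum oQ j rl)). Qed.

Let odeN := fun i j => @hjet_ode_rhs R n Q M L oQ sL rkL N i j.

(** From order 2 on, the [q]-th components differ by the [(q - 2)]-fold flow derivative of the
    defect of the unreduced equation. *)
Lemma hflat_subst_jet k : (k <= N)%N ->
  (forall j, hflat U k (fun p => flow_rhs (ode_rhs L) j p - acceleration j p)) ->
  forall q j, hflat U k (fun p => subst_jet L N p.2 (flow_jet p) q 0 j - flow_jet p q 0 j).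
Proof.
move=> kN ode_flat q j.
have [q2|q2] := ltnP q 2.
  apply: (hflat_ext oU (f := fun=> 0)); last exact: hflat_cst0.
  by move=> p _; rewrite subst_jet_lt2// subrr.
have sr : smooth_on C (flow_rhs (ode_rhs L) j) by exact: (smooth_flow_rhs j odeN).
have sa := smooth_acceleration j.
apply: (hflat_ext oU (f := iter (q - 2) XA
    (fun p => flow_rhs (ode_rhs L) j p - acceleration j p))); last first.
  by apply: hflat_iter_XA => //; exact: (smooth_onB oC).
move=> p Cp; rewrite iter_XAB// subst_jet_ge2//; congr (_ - _).
  exact: (iter_XA_flow_jet _ (hjet_hsum oQ j odeN)).
by case: q q2 => [|[|q]] // _; rewrite mxE /= !subSS subn0.
Qed.

(** The substitution moves the jet by O(h^k). The term [r 0] does not notice this, and every other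
    term carries a factor h, which gives the extra order; expanding and truncating after h^N costs
    only O(h^(N+1)). *)
Lemma hflat_substitute_step k l r j : (k <= N)%N -> hjet_family Q N l r ->
  (forall j, hjet Q 1 (fun _ J => r 0%N J 0 j)) ->
  (forall j, hflat U k (fun p => flow_rhs (ode_rhs L) j p - acceleration j p)) ->
  hflat U k.+1 (fun p => flow_rhs r j p - flow_rhs (substitute L N r) j p).
Proof.
move=> kN rl r0 ode_flat; pose m := (ode_order M N + l)%N.
pose F h J := hsum N r h (subst_jet L N h J) 0 j.
have Fm : hjet Q m F by exact: hjet_hsum_subst.
have sl : hjet_family Q N m (substitute L N r).
  by move=> i j' _; exact: hjet_substitute.
pose S h J := hsum N (substitute L N r) h J 0 j.
have Sm : hjet Q m S by exact: hjet_hsum.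
pose E h J := F h J + (-1) * S h J.
have Em : hjet Q m E by apply/(hjetD oQ Fm)/(hjetM oQ)/Sm/(hjet_cst oQ).
have oD := open_mx_dom oQ m.
(* [E] is the Taylor remainder of the substituted right-hand side on the jet space, before it is
   pulled back along [sigma]. *)
have Eflat : hflat (mx_dom Q m) N.+1 (fun q => E q.2 (jet_of_mx q.1)).
  apply: (hflat_ext oD _ (hflat_taylor oD (N := N) (proj2 Fm))) => q Dq.
  rewrite /E mulN1r /S hsum_entry; congr (_ - _); apply: eq_bigr => i _.
  by rewrite mxE /hcoef iter_Dh_slice.
have EF := hflat_jet_comp oQ oU Em (flow_jet_smooth m) Eflat.
pose T i p := r i (subst_jet L N p.2 (flow_jet p)) 0 j - r i (flow_jet p) 0 j.
have srs i : (i <= N)%N -> smooth_on C (fun p => r i (subst_jet L N p.2 (flow_jet p)) 0 j).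
  by move=> iN; exact: (smooth_on_flow (hjet_term_subst oQ sL rkL N (rl i j iN))).
have sr i : (i <= N)%N -> smooth_on C (fun p => r i (flow_jet p) 0 j).
  by move=> iN; exact: (smooth_on_flow (rl i j iN)).
have sT (i : 'I_N.+1) : smooth_on C (T i).
  have iN : (i <= N)%N by rewrite -ltnS.
  by apply: (smooth_onB oC); [exact: srs|exact: sr].
have sX i : smooth_on C (fun p => p.2 ^+ i : R) by exact/(smooth_onX oC)/(smooth_snd oU).
have sub_smooth q : smooth_jet Q U q (fun p => subst_jet L N p.2 (flow_jet p)).
  split=> [i j' iq|p Cp]; first exact: (smooth_on_flow (hjet_subst_jet oQ sL rkL N j' iq)).
  by rewrite subst_jet_lt2//; exact: (proj2 (flow_jet_smooth 0)).
have FT : hflat U k.+1 (fun p => \sum_(i < N.+1) p.2 ^+ i * T i p).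
  apply: (hflat_sum oU) => i; first exact: (smooth_onM oC (sX i)).
  have iN : (i <= N)%N by rewrite -ltnS.
  have [i0|i0] := posnP i.
    apply: (hflat_ext oU (f := fun=> 0)); last exact: hflat_cst0.
    move=> p Cp; rewrite /T i0; have [+ _] := r0 j => /(_ 0) r0o.
    have [_ QF] := flow_jet_smooth 0.
    rewrite (r0o (flow_jet p) (subst_jet L N p.2 (flow_jet p)) (QF _ Cp)) ?subrr ?mulr0//.
    by move=> q q1; rewrite subst_jet_lt2.
  apply: (@hflat_le _ _ _ (i + k)); first by rewrite -add1n leq_add2r.
  apply: (hflat_expM oU) => //.
  apply: (hflat_jet_sub oU (f := fun _ J => r i J 0 j) (rl i j iN)) => //.
    exact: flow_jet_smooth.
  by move=> q j' _; exact: hflat_subst_jet.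
apply: (hflat_ext oU (f := fun p => E p.2 (flow_jet p) - \sum_(i < N.+1) p.2 ^+ i * T i p)).
  move=> p Cp; rewrite /E /F /S mulN1r [hsum N r _ (subst_jet _ _ _ _) _ _]hsum_entry.
  rewrite /flow_rhs [X in _ = X - _]hsum_entry addrAC; congr (_ - _).
  rewrite -sumrB; apply: eq_bigr => i _.
  by rewrite /T mulrBr opprB addrC subrK.
apply: (hflatB oU) => //; last by apply: hflat_le EF.
- exact: (smooth_on_flow Em).
- by apply: (smooth_on_sum oC) => i; exact: (smooth_onM oC (sX i)).
Qed.

Lemma hflat_flow_rhs k : (k <= N.+1)%N ->
  forall j, hflat U k (fun p => flow_rhs (ode_rhs L) j p - acceleration j p).
Proof.
elim: k => [//|k IH] kN j; have {}IH := IH (ltnW kN).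
have [s sa] := red.
pose rs t := iter t (substitute L N) (ode_rhs L).
have rs0 t i : hjet Q 1 (fun _ J => rs t 0%N J 0 i).
  elim: t i => [|t IHt] i; first exact: hjet_ode_rhs0.
  have [l ls] := hjet_iter_substitute oQ sL rkL N t.
  apply: (substitute_order1 oQ sL rkL ls _ (leq0n N) _ (leqnn 0)) => i' j'.
  by rewrite leqn0 => /eqP ->; exact: IHt.
(* With a defect flat to order [k], each round changes the right-hand side along [sigma] only to
   order [k + 1]. After [s] rounds it is [A], so the defect itself has gained an order. *)
have chain t : hflat U k.+1 (fun p => flow_rhs (ode_rhs L) j p - flow_rhs (rs t) j p).
  elim: t => [|t IHt].
    by apply: (hflat_ext oU (f := fun=> 0)) => [p _|]; [rewrite subrr|exact: hflat_cst0].
  have [l ls] := hjet_iter_substitute oQ sL rkL N t.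
  have [l' ls'] := hjet_iter_substitute oQ sL rkL N t.+1.
  have := hflat_substitute_step j kN ls (rs0 t) IH.
  have s1 := smooth_flow_rhs j ls; have s2 := smooth_flow_rhs j ls'.
  have s0 := smooth_flow_rhs j odeN.
  move=> /(hflatD oU (smooth_onB oC s0 s1) (smooth_onB oC s1 s2) IHt).
  by apply: (hflat_ext oU) => p _; rewrite addrA subrK.
apply: (hflat_ext oU _ (chain s)) => p Cp; congr (_ - _).
rewrite /flow_rhs /acceleration !hsum_entry; apply: eq_bigr => i _.
rewrite [rs s i _]sa; first by rewrite (flow_jet1 Cp erefl).
- by rewrite -ltnS.
- exact: (proj2 (flow_jet_smooth 0)).
Qed.

(** * Ostrogradsky's one-form and energy *)

Section Momenta.
Variable i : nat.
Local Notation K := (lag_order M i).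

Definition lag_partial k j p : R := jpartial k j (lag L i) (flow_jet p).

Lemma hjet_lag_partial k j : hjet Q K (fun _ => jpartial k j (lag L i)).
Proof. exact: (hjet_jpartial oQ k j (hjet_lag oQ sL i)). Qed.

Lemma smooth_lag_partial k j : smooth_on C (lag_partial k j).
Proof. exact: (smooth_on_flow (hjet_lag_partial k j)). Qed.

(** The recursion [P_k = dL/dphi^(k+1) - XA P_(k+1)] descends from [P_K = 0]; it is indexed by the
    distance [d = K - k] from the top to be structural. *)
Fixpoint horner_momentum d j : Z * R -> R :=
  match d with
  | 0 => fun=> 0
  | d.+1 => fun p => lag_partial (K - d) j p - XA (horner_momentum d j) p
  end.

(* Ostrogradsky's momentum conjugate to phi^(k). *)
Definition momentum k j : Z * R -> R := horner_momentum (K - k) j.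

Lemma smooth_horner_momentum d j : smooth_on C (horner_momentum d j).
Proof.
elim: d => [|d IH] /=; first exact: (smooth_on_cst oC).
by apply: (smooth_onB oC); [exact: smooth_lag_partial|exact: smooth_XA].
Qed.

Lemma smooth_momentum k j : smooth_on C (momentum k j).
Proof. exact: smooth_horner_momentum. Qed.

Lemma momentum_last j p : momentum K j p = 0.
Proof. by rewrite /momentum subnn. Qed.

Lemma momentumS k j p : (k < K)%N ->
  momentum k j p = lag_partial k.+1 j p - XA (momentum k.+1 j) p.
Proof.
by move=> kK; rewrite /momentum -[(K - k)%N]prednK ?subn_gt0//= -subnS subKn.
Qed.

Lemma XA_sum (I : Type) (r : seq I) (F : I -> Z * R -> R) p :
  (forall l, smooth_on C (F l)) -> C p ->
  XA (fun p => \sum_(l <- r) F l p) p = \sum_(l <- r) XA (F l) p.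
Proof. by move=> sF Cp; exact: (smooth_derive_sum oC _ Cp). Qed.

Lemma horner_momentumE d j p : (d <= K.+1)%N -> C p ->
  horner_momentum d j p =
  \sum_(l < d) (-1) ^+ l * iter l XA (lag_partial (l + K.+1 - d) j) p.
Proof.
elim: d p => [|d IH] p dK Cp; first by rewrite big_ord0.
rewrite big_ord_recl /= expr0 mul1r add0n subSS; congr (_ + _).
have sl (l : 'I_d) : smooth_on C (iter l XA (lag_partial (l + K.+1 - d) j)).
  exact/smooth_iter_XA/smooth_lag_partial.
have sll (l : 'I_d) : smooth_on C (fun p =>
    (-1) ^+ l * iter l XA (lag_partial (l + K.+1 - d) j) p).
  exact: (smooth_onM oC (smooth_on_cst oC _) (sl l)).
rewrite (XA_ext (fun p => IH p (ltnW dK)) Cp).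
rewrite (XA_sum _ sll Cp).
rewrite -sumrN; apply: eq_bigr => l _.
rewrite /XA (smooth_deriveZ oC _ Cp)// /bump /= add1n exprS mulN1r mulNr addSn subSS.
by [].
Qed.

(** The Euler-Lagrange expression is one more Horner step, a momentum of index -1. *)
Lemma euler_lagrange_flow j p : C p ->
  lag_partial 0 j p - XA (momentum 0 j) p = euler_lagrange L i (flow_jet p) 0 j.
Proof.
move=> Cp; rewrite /momentum subn0.
have -> : lag_partial 0 j p - XA (horner_momentum K j) p = horner_momentum K.+1 j p.
  by rewrite /= subnn.
rewrite horner_momentumE// mxE; apply: eq_bigr => l _; congr (_ * _).
by rewrite addnK; exact: (iter_XA_flow_jet _ (hjet_lag_partial l j)).
Qed.

(** Pullback of Ostrogradsky's one-form: [Dz b (flow_coord k j)] are the entries of the Jacobian of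
    [sigma] at fixed h. *)
Definition theta b p : R := \sum_(k < K) \sum_j momentum k j p * Dz b (flow_coord k j) p.

Definition energy p : R :=
  \sum_(k < K) \sum_j momentum k j p * flow_coord k.+1 j p - lag L i (flow_jet p).

Lemma smooth_Dflow b k j : smooth_on C (Dz b (flow_coord k j)).
Proof. exact/smooth_Dz/smooth_flow_coord. Qed.

Lemma smooth_theta b : smooth_on C (theta b).
Proof.
apply: (smooth_on_sum oC) => k; apply: (smooth_on_sum oC) => j.
by apply: (smooth_onM oC); [exact: smooth_momentum|exact: smooth_Dflow].
Qed.

Lemma smooth_lag_flow : smooth_on C (fun p => lag L i (flow_jet p)).
Proof. exact: (smooth_on_flow (hjet_lag oQ sL i)). Qed.

Lemma smooth_energy : smooth_on C energy.
Proof.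
apply: (smooth_onB oC); last exact: smooth_lag_flow.
apply: (smooth_on_sum oC) => k; apply: (smooth_on_sum oC) => j.
by apply: (smooth_onM oC); [exact: smooth_momentum|exact: smooth_flow_coord].
Qed.

Lemma Dz_sum2 b d (F : nat -> 'I_n -> Z * R -> R) p :
  (forall k j, smooth_on C (F k j)) -> C p ->
  Dz b (fun p => \sum_(k < d) \sum_j F k j p) p = \sum_(k < d) \sum_j Dz b (F k j) p.
Proof.
move=> sF Cp; rewrite /Dz (smooth_derive_sum oC _ Cp).
  by apply: eq_bigr => k _; rewrite (smooth_derive_sum oC _ Cp).
by move=> k; exact: (smooth_on_sum oC).
Qed.

Lemma Dz_lag c p : C p -> Dz c (fun p => lag L i (flow_jet p)) p =
  \sum_(k < K.+1) \sum_j lag_partial k j p * Dz c (flow_coord k j) p.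
Proof.
move=> Cp; have [sF QF] := flow_jet_smooth K.
rewrite /Dz (hjet_chain oQ oC (smooth_snd oU) sF QF _ (hjet_lag oQ sL i) Cp).
rewrite derive_comp_snd mul0r addr0.
apply: eq_bigr => k _; apply: eq_bigr => j _; rewrite mulrC; congr (_ * _).
by apply: (derive_ext _ oC) => // p' _; rewrite mxE.
Qed.

(* For the one-form P d(phi), contracting -d(P d(phi)) with the flow gives
   phi' dP - (dP/dt) d(phi). *)
Lemma contract_pdq k j c p : C p ->
  \sum_b flow_field p 0 b *
    (Dz c (fun p => momentum k j p * Dz b (flow_coord k j) p) p -
     Dz b (fun p => momentum k j p * Dz c (flow_coord k j) p) p) =
  Dz c (momentum k j) p * flow_coord k.+1 j p -
  XA (momentum k j) p * Dz c (flow_coord k j) p.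
Proof.
move=> Cp; have sP := smooth_momentum k j; have sq := smooth_flow_coord k j.
rewrite -XA_flow_coord// (XA_Dz sq Cp) (XA_Dz sP Cp) mulr_sumr mulr_suml -sumrB.
apply: eq_bigr => b _.
have DM d e : Dz d (fun p => momentum k j p * Dz e (flow_coord k j) p) p =
    Dz d (momentum k j) p * Dz e (flow_coord k j) p +
    momentum k j p * Dz d (Dz e (flow_coord k j)) p.
  exact: (smooth_deriveM _ Cp sP (smooth_Dflow e k j)).
have DD : Dz c (Dz b (flow_coord k j)) p = Dz b (Dz c (flow_coord k j)) p.
  exact: (smooth_derive_comm oC _ _ sq Cp).
have alg (u cP bq P cbq bP cq : R) :
    u * (cP * bq + P * cbq - (bP * cq + P * cbq)) = cP * (u * bq) - u * bP * cq.
  by ring.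
by rewrite !DM DD; exact: alg.
Qed.

(** Summation by parts: [dL/dphi^(k) = P_(k-1) + XA P_k] for [k > 0], and [EL + XA P_0] for [k = 0].
    As [P_K = 0], the last sum may be extended to [k = K]. *)
Lemma sum_lag_partial c p : C p ->
  \sum_(k < K.+1) \sum_j lag_partial k j p * Dz c (flow_coord k j) p =
  \sum_j euler_lagrange L i (flow_jet p) 0 j * Dz c (flow_coord 0 j) p +
  \sum_(k < K) \sum_j momentum k j p * Dz c (flow_coord k.+1 j) p +
  \sum_(k < K) \sum_j XA (momentum k j) p * Dz c (flow_coord k j) p.
Proof.
move=> Cp.
have XAK j : XA (momentum K j) p = 0.
  rewrite (@XA_ext _ (fun=> 0) _ p Cp) => [|p' _]; last exact: momentum_last.
  by rewrite /XA derive_cst.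
have -> : \sum_(k < K) \sum_j XA (momentum k j) p * Dz c (flow_coord k j) p =
    \sum_(k < K.+1) \sum_j XA (momentum k j) p * Dz c (flow_coord k j) p.
  rewrite big_ord_recr /= [X in _ = _ + X]big1 ?addr0// => j _.
  by rewrite XAK mul0r.
apply/eqP; rewrite -subr_eq; apply/eqP; rewrite -sumrB.
under eq_bigr do rewrite -sumrB.
rewrite big_ord_recl; congr (_ + _); apply: eq_bigr.
  by move=> j _; rewrite -mulrBl -euler_lagrange_flow.
by move=> k _; apply: eq_bigr => j _; rewrite -mulrBl -momentumS.
Qed.

(** No equation of motion is used: the coefficient [L^i] alone does not govern the flow, and its
    Euler-Lagrange expression stays on the right. Only the sum over [i] is small. *)
Theorem hamilton_identity c p : C p ->
  \sum_b flow_field p 0 b * (Dz c (theta b) p - Dz b (theta c) p) =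
  Dz c energy p +
  \sum_j euler_lagrange L i (flow_jet p) 0 j * Dz c (flow_coord 0 j) p.
Proof.
move=> Cp.
have sPq k j b : smooth_on C (fun p => momentum k j p * Dz b (flow_coord k j) p).
  by apply: (smooth_onM oC); [exact: smooth_momentum|exact: smooth_Dflow].
have sPv k j : smooth_on C (fun p => momentum k j p * flow_coord k.+1 j p).
  by apply: (smooth_onM oC); [exact: smooth_momentum|exact: smooth_flow_coord].
have -> : \sum_b flow_field p 0 b * (Dz c (theta b) p - Dz b (theta c) p) =
    \sum_(k < K) \sum_j (Dz c (momentum k j) p * flow_coord k.+1 j p -
      XA (momentum k j) p * Dz c (flow_coord k j) p).
  have T b d : Dz d (theta b) p = \sum_(k < K) \sum_j
      Dz d (fun p => momentum k j p * Dz b (flow_coord k j) p) p.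
    by rewrite (Dz_sum2 d K (fun k j => sPq k j b)).
  under eq_bigr => b _.
    rewrite !T -sumrB mulr_sumr; under eq_bigr => k _ do rewrite -sumrB mulr_sumr.
  over.
  rewrite exchange_big; apply: eq_bigr => k _; rewrite exchange_big.
  by apply: eq_bigr => j _; exact: contract_pdq.
have -> : Dz c energy p = \sum_(k < K) \sum_j (Dz c (momentum k j) p * flow_coord k.+1 j p +
      momentum k j p * Dz c (flow_coord k.+1 j) p) -
    \sum_(k < K.+1) \sum_j lag_partial k j p * Dz c (flow_coord k j) p.
  rewrite -Dz_lag// /Dz (smooth_deriveB _ Cp _ smooth_lag_flow); last first.
    by apply: (smooth_on_sum oC) => k; exact: (smooth_on_sum oC).
  congr (_ - _); apply: (etrans (Dz_sum2 c K sPv Cp)); apply: eq_bigr => k _.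
  apply: eq_bigr => j _.
  by rewrite /Dz (smooth_deriveM _ Cp (smooth_momentum k j) (smooth_flow_coord k.+1 j)).
rewrite sum_lag_partial//.
have sum2 (F G : nat -> 'I_n -> R) : \sum_(k < K) \sum_j (F k j + G k j) =
    \sum_(k < K) \sum_j F k j + \sum_(k < K) \sum_j G k j.
  by rewrite -big_split; apply: eq_bigr => k _; rewrite big_split.
rewrite (sum2 (fun k j => Dz c (momentum k j) p * flow_coord k.+1 j p)
  (fun k j => - (XA (momentum k j) p * Dz c (flow_coord k j) p))).
rewrite (sum2 (fun k j => Dz c (momentum k j) p * flow_coord k.+1 j p)
  (fun k j => momentum k j p * Dz c (flow_coord k.+1 j) p)).
have -> : \sum_(k < K) \sum_j - (XA (momentum k j) p * Dz c (flow_coord k j) p) =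
    - \sum_(k < K) \sum_j XA (momentum k j) p * Dz c (flow_coord k j) p.
  by rewrite -sumrN; apply: eq_bigr => k _; rewrite sumrN.
by ring.
Qed.

End Momenta.

(** * Truncation after h^N *)

Lemma Dz_slice c f z h : Dz c f (z, h) = 'D_(delta_mx 0 c) (fun y => f (y, h)) z.
Proof. exact: derive_fst_slice. Qed.

Lemma Dz_hpoly c d (F : nat -> Z * R -> R) p :
  (forall i, (i < d)%N -> smooth_on C (F i)) -> C p ->
  Dz c (fun p => \sum_(i < d) p.2 ^+ i * F i p) p = \sum_(i < d) p.2 ^+ i * Dz c (F i) p.
Proof.
case: p => z h sF Uz; rewrite Dz_slice /=.
have sFh (i : 'I_d) : smooth_on U (fun y => F i (y, h)) by exact/smooth_slice/sF.
rewrite (smooth_derive_sum oU _ Uz) => [|i]; last exact: (smooth_onM oU (smooth_on_cst oU _)).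
by apply: eq_bigr => i _; rewrite (smooth_deriveZ oU _ Uz)// Dz_slice.
Qed.

(** Each [theta i] still depends on h through [sigma], so this is not yet an expansion in h;
    [theta_coef] re-expands it, and [energy_coef] does so for [Energy]. *)
Definition Theta b p : R := \sum_(i < N.+1) p.2 ^+ i * theta i b p.
Definition Energy p : R := \sum_(i < N.+1) p.2 ^+ i * energy i p.

Let smooth_exp i : smooth_on C (fun p => p.2 ^+ i : R).
Proof. exact/(smooth_onX oC)/(smooth_snd oU). Qed.

Lemma smooth_Theta b : smooth_on C (Theta b).
Proof.
by apply: (smooth_on_sum oC) => i; exact: (smooth_onM oC (smooth_exp i) (smooth_theta i b)).
Qed.

Lemma smooth_Energy : smooth_on C Energy.
Proof.
by apply: (smooth_on_sum oC) => i; exact: (smooth_onM oC (smooth_exp i) (smooth_energy i)).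
Qed.

Definition el_sum j p : R := \sum_(i < N.+1) p.2 ^+ i * euler_lagrange L i (flow_jet p) 0 j.

(** Along [sigma] the component [phi^(2)] is the acceleration, so factoring out the Hessian exposes
    the defect controlled by [hflat_flow_rhs]. *)
Lemma el_sumE j p : C p -> el_sum j p =
  \sum_l (flow_rhs (ode_rhs L) l p - acceleration l p) * jhessian 1 (lag L 0) (flow_jet p) l j.
Proof.
move=> Cp; have QJ : Q (flow_jet p 0%N) by exact: (proj2 (flow_jet_smooth 0)).
have -> : el_sum j p = (\sum_(i < N.+1) p.2 ^+ i *: euler_lagrange L i (flow_jet p)) 0 j.
  by rewrite summxE; apply: eq_bigr => i _; rewrite [RHS]mxE.
have -> : \sum_(i < N.+1) p.2 ^+ i *: euler_lagrange L i (flow_jet p) =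
    (hsum N (ode_rhs L) p.2 (flow_jet p) - flow_jet p 2%N) *m jhessian 1 (lag L 0) (flow_jet p).
  rewrite /hsum !big_ord_recl !expr0 !scale1r euler_lagrange0_ode ?rkL//.
  rewrite [in RHS]addrAC [RHS]mulmxDl; congr (_ + _); rewrite mulmx_suml; apply: eq_bigr => i _.
  by rewrite lift0 euler_lagrangeS_ode ?rkL// scalemxAl.
rewrite mxE; apply: eq_bigr => l _; congr (_ * _).
by rewrite !mxE.
Qed.

Lemma smooth_el_sum j : smooth_on C (el_sum j).
Proof.
apply: (smooth_on_sum oC) => i; apply: (smooth_onM oC) => //.
exact: (smooth_on_flow (hjet_euler_lagrange oQ sL i j)).
Qed.

Lemma hflat_el_sum j : hflat U N.+1 (el_sum j).
Proof.
apply: (hflat_ext oU (f := fun p => \sum_l (flow_rhs (ode_rhs L) l p - acceleration l p) *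
    jhessian 1 (lag L 0) (flow_jet p) l j)).
  by move=> p Cp; rewrite el_sumE.
have sd l : smooth_on C (fun p => flow_rhs (ode_rhs L) l p - acceleration l p).
  by apply: (smooth_onB oC); [exact: (smooth_flow_rhs l odeN)|exact: smooth_acceleration].
have sW l := smooth_on_flow (hjet_hessian oQ sL l j).
apply: (hflat_sum oU) => l; first exact: (smooth_onM oC).
by apply: (hflatMl oU) => //; exact: hflat_flow_rhs.
Qed.

Lemma hamilton_sum c p : C p ->
  \sum_b flow_field p 0 b * (Dz c (Theta b) p - Dz b (Theta c) p) - Dz c Energy p =
  \sum_j el_sum j p * Dz c (flow_coord 0 j) p.
Proof.
move=> Cp.
have DT b d : Dz d (Theta b) p = \sum_(i < N.+1) p.2 ^+ i * Dz d (theta i b) p.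
  by rewrite (Dz_hpoly d (fun i _ => smooth_theta i b) Cp).
have DE : Dz c Energy p = \sum_(i < N.+1) p.2 ^+ i * Dz c (energy i) p.
  by rewrite (Dz_hpoly c (fun i _ => smooth_energy i) Cp).
under eq_bigr => b _.
  rewrite !DT -sumrB mulr_sumr; under eq_bigr => i _ do rewrite -mulrBr mulrCA.
  over.
rewrite exchange_big /= DE -sumrB.
apply: (@etrans _ _ (\sum_(i < N.+1)
    \sum_j p.2 ^+ i * (euler_lagrange L i (flow_jet p) 0 j * Dz c (flow_coord 0 j) p))).
  apply: eq_bigr => i _.
  by rewrite -!mulr_sumr -mulrBr hamilton_identity// addrAC subrr add0r.
rewrite exchange_big /=; apply: eq_bigr => j _; rewrite /el_sum mulr_suml.
by apply: eq_bigr => i _; rewrite mulrA.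
Qed.

Definition theta_coef k b : Z -> R := hcoef k (Theta b).

(** The coefficients of [- dTheta]; the sign turns the one-form [p dq] into [dq /\ dp]. As
    derivatives of the coefficients of the one-form, they have exact truncations. *)
Definition omega_coef k z : 'M[R]_(n + n) := \matrix_(c, d)
  ('D_(delta_mx 0 d) (theta_coef k c) z - 'D_(delta_mx 0 c) (theta_coef k d) z).

Definition energy_coef k : Z -> R := hcoef k Energy.

Definition ThetaN b p : R := \sum_(k < N.+1) p.2 ^+ k * theta_coef k b p.1.

Lemma smooth_theta_coef k b : smooth_on U (theta_coef k b).
Proof. exact/(smooth_hcoef oU)/smooth_Theta. Qed.

Lemma smooth_energy_coef k : smooth_on U (energy_coef k).
Proof. exact/(smooth_hcoef oU)/smooth_Energy. Qed.

Lemma smooth_omega_coef k c d : smooth_on U (fun z => omega_coef k z c d).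
Proof.
apply: (smooth_on_ext oU (f := fun z =>
  'D_(delta_mx 0 d) (theta_coef k c) z - 'D_(delta_mx 0 c) (theta_coef k d) z)).
  by move=> z _; rewrite mxE.
by apply: (smooth_onB oU); apply: smooth_on_derive; exact: smooth_theta_coef.
Qed.

Lemma smooth_ThetaN b : smooth_on C (ThetaN b).
Proof.
by apply: (smooth_hpoly oU (c := theta_coef^~ b)) => k _; exact: smooth_theta_coef.
Qed.

Lemma hsum_omega h z c d : U z -> hsum N omega_coef h z c d =
  Dz d (ThetaN c) (z, h) - Dz c (ThetaN d) (z, h).
Proof.
move=> Uz; have DT b e : Dz e (ThetaN b) (z, h) =
    \sum_(k < N.+1) h ^+ k * 'D_(delta_mx 0 e) (theta_coef k b) z.
  have sT k : (k < N.+1)%N -> smooth_on C (fun p => theta_coef k b p.1).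
    by move=> _; exact: (smooth_comp_fst oU (smooth_theta_coef k b)).
  by rewrite (Dz_hpoly e sT (Uz : C (z, h))); apply: eq_bigr => k _; rewrite Dz_slice.
rewrite hsum_entry !DT -sumrB; apply: eq_bigr => k _.
by rewrite mxE mulrBr.
Qed.

Lemma differential_energy h z c :
  differential (hsum N energy_coef h) z 0 c = Dz c (fun p => hsum N energy_coef p.2 p.1) (z, h).
Proof. by rewrite mxE Dz_slice. Qed.

Definition hamilton_defect h z : 'rV[R]_(n + n) :=
  flow_field (z, h) *m hsum N omega_coef h z - differential (hsum N energy_coef h) z.

Lemma smooth_hsum_energy : smooth_on C (fun p => hsum N energy_coef p.2 p.1).
Proof.
by apply: (smooth_hpoly oU (c := energy_coef)) => k _; exact: smooth_energy_coef.
Qed.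

Lemma smooth_hsum_omega c d : smooth_on C (fun p => hsum N omega_coef p.2 p.1 c d).
Proof.
apply: (smooth_on_ext oC (f := fun p => \sum_(k < N.+1) p.2 ^+ k * omega_coef k p.1 c d)).
  by move=> p _; rewrite hsum_entry.
by apply: (smooth_hpoly oU (c := fun k z => omega_coef k z c d)) => k _; exact: smooth_omega_coef.
Qed.

(** Linear in the pair [(T, E)], so that truncation errors can be split off. *)
Let hamilton_lhs (T : 'I_(n + n) -> Z * R -> R) (E : Z * R -> R) c p : R :=
  \sum_b flow_field p 0 b * (Dz c (T b) p - Dz b (T c) p) - Dz c E p.

Let smooth_lhs T E c : (forall b, smooth_on C (T b)) -> smooth_on C E ->
  smooth_on C (hamilton_lhs T E c).
Proof.
move=> sT sE; apply: (smooth_onB oC); last exact: smooth_Dz.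
apply: (smooth_on_sum oC) => b; apply: (smooth_onM oC); first exact: smooth_flow_field.
by apply: (smooth_onB oC); exact: smooth_Dz.
Qed.

Let hflat_lhs k T E c : (forall b, smooth_on C (T b)) -> smooth_on C E ->
  (forall b, hflat U k (T b)) -> hflat U k E -> hflat U k (hamilton_lhs T E c).
Proof.
move=> sT sE fT fE.
have sD b d := smooth_Dz d (sT b).
have fD b d : hflat U k (Dz d (T b)) := hflat_derive_fst oU (delta_mx 0 d) (sT b) (fT b).
have sB b := smooth_onB oC (sD b c) (sD c b).
apply: (hflatB oU).
- apply: (smooth_on_sum oC) => b.
  by apply: (smooth_onM oC) => //; exact: smooth_flow_field.
- exact: smooth_Dz.
- apply: (hflat_sum oU) => b.
    by apply: (smooth_onM oC) => //; exact: smooth_flow_field.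
  apply: (hflatMr oU) => //; first exact: smooth_flow_field.
  by apply: (hflatB oU).
- exact: (hflat_derive_fst oU).
Qed.

Lemma hamilton_defectE h z c : U z ->
  hamilton_defect h z 0 c = hamilton_lhs ThetaN (fun p => hsum N energy_coef p.2 p.1) c (z, h).
Proof.
move=> Uz; rewrite mxE [(- differential _ _) _ _]mxE differential_energy; congr (_ - _).
by rewrite mxE; apply: eq_bigr => b _; rewrite hsum_omega.
Qed.

(** By linearity the defect of the truncated pair is the Euler-Lagrange term minus the contribution
    of the Taylor remainders; these are flat, and only z-derivatives of them occur. *)
Lemma hamilton_defect_bigO c : bigO_h U N.+1 (fun h z => hamilton_defect h z 0 c).
Proof.
have sT := smooth_ThetaN; have sE := smooth_hsum_energy.
have E p : C p -> hamilton_lhs ThetaN (fun p => hsum N energy_coef p.2 p.1) c p =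
    hamilton_defect p.2 p.1 0 c.
  by case: p => z h Uz; rewrite hamilton_defectE.
apply: (bigO_h_flat open_Jet1).
  exact: (smooth_on_ext oC E (smooth_lhs c sT sE)).
apply: (hflat_ext oU E).
have sdT b := smooth_onB oC (smooth_Theta b) (sT b).
have sdE := smooth_onB oC smooth_Energy sE.
have fdT b : hflat U N.+1 (fun p => Theta b p - ThetaN b p).
  exact: (hflat_taylor oU (smooth_Theta b)).
have fdE : hflat U N.+1 (fun p => Energy p - hsum N energy_coef p.2 p.1).
  exact: (hflat_taylor oU smooth_Energy).
apply: (hflat_ext oU (f := fun p => \sum_j el_sum j p * Dz c (flow_coord 0 j) p -
    hamilton_lhs (fun b p => Theta b p - ThetaN b p)
      (fun p => Energy p - hsum N energy_coef p.2 p.1) c p)).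
  move=> p Cp; rewrite -hamilton_sum// /hamilton_lhs.
  have DT b d : Dz d (fun p => Theta b p - ThetaN b p) p =
      Dz d (Theta b) p - Dz d (ThetaN b) p.
    exact: (smooth_deriveB _ Cp (smooth_Theta b) (sT b)).
  have DE : Dz c (fun p => Energy p - hsum N energy_coef p.2 p.1) p =
      Dz c Energy p - Dz c (fun p => hsum N energy_coef p.2 p.1) p.
    exact: (smooth_deriveB _ Cp smooth_Energy sE).
  have split_sum : \sum_b flow_field p 0 b * (Dz c (Theta b) p - Dz b (Theta c) p) =
      \sum_b flow_field p 0 b * (Dz c (fun p => Theta b p - ThetaN b p) p -
        Dz b (fun p => Theta c p - ThetaN c p) p) +
      \sum_b flow_field p 0 b * (Dz c (ThetaN b) p - Dz b (ThetaN c) p).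
    have alg (u x y x' y' : R) : u * (x - y) = u * (x - x' - (y - y')) + u * (x' - y').
      by ring.
    by rewrite -big_split; apply: eq_bigr => b _ /=; rewrite !DT; exact: alg.
  have alg (t s' y e : R) : t + s' - e - (t - (e - y)) = s' - y by ring.
  by rewrite split_sum DE; exact: alg.
have sDq j : smooth_on C (fun p => el_sum j p * Dz c (flow_coord 0 j) p).
  by apply: (smooth_onM oC); [exact: smooth_el_sum|exact: smooth_Dflow].
apply: (hflatB oU); [exact: (smooth_on_sum oC)|exact: smooth_lhs| |exact: hflat_lhs].
apply: (hflat_sum oU) => // j; apply: (hflatMl oU); [exact: smooth_el_sum|exact: smooth_Dflow|].
exact: hflat_el_sum.
Qed.

(** At fixed h the form is minus the exterior derivative of [ThetaN], and the second derivatives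
    cancel in three pairs. *)
Lemma omega_closed h : closed_form U (hsum N omega_coef h).
Proof.
move=> z Uz b c d; rewrite !mxE.
pose T e y := ThetaN e (y, h).
have sT e : smooth_on U (T e) by exact/smooth_slice/smooth_ThetaN.
have wE e e1 : forall y, U y -> hsum N omega_coef h y e e1 =
    'D_(delta_mx 0 e1) (T e) y - 'D_(delta_mx 0 e) (T e1) y.
  by move=> y Uy; rewrite hsum_omega// !Dz_slice.
have sDT e e1 : smooth_on U ('D_(delta_mx 0 e1) (T e)) by exact: smooth_on_derive.
have Dw e e1 e2 : 'D_(delta_mx 0 e2) (fun y => hsum N omega_coef h y e e1) z =
    'D_(delta_mx 0 e2) ('D_(delta_mx 0 e1) (T e)) z -
    'D_(delta_mx 0 e2) ('D_(delta_mx 0 e) (T e1)) z.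
  by rewrite (derive_ext _ oU (wE e e1) Uz) (smooth_deriveB _ Uz).
rewrite !Dw.
have S (e i j : 'I_(n + n)) : 'D_(delta_mx 0 i) ('D_(delta_mx 0 j) (T e)) z =
    'D_(delta_mx 0 j) ('D_(delta_mx 0 i) (T e)) z.
  exact: (smooth_derive_comm oU).
have alg (x x' y y' t t' : R) : x = x' -> y = y' -> t = t' ->
    x - y + (y' - t) + (t' - x') = 0 by move=> -> -> ->; ring.
by apply: alg; exact: S.
Qed.

(** * The structure at h = 0 *)

Section ZerothOrder.
Variable z : Z.
Hypothesis Uz : U z.

Lemma flow_jet_eq1 h : eq_jet 1 (flow_jet (z, h)) (jet_of1 z).
Proof. by case=> [|[|]]// _; apply/rowP => j; rewrite !mxE. Qed.

Lemma lag_partial0 h j : lag_partial 0 1 j (z, h) = coord_p L j z.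
Proof.
have [order_eq _] := hjet_lag_partial 0 1 j; apply: (order_eq 0); last exact: flow_jet_eq1.
exact: (proj2 (flow_jet_smooth 0)).
Qed.

(** As [L^0] has order 1, the recursion stops after one step with the momentum of index 1 equal to
    0; nothing depends on h. *)
Lemma momentum0 j h : momentum 0 0 j (z, h) = coord_p L j z.
Proof.
rewrite momentumS// (@XA_ext _ (fun=> 0) _ (z, h) Uz) => [|p _]; last exact: momentum_last.
by rewrite /XA derive_cst subr0 lag_partial0.
Qed.

Lemma hcoef0 f : hcoef 0 f z = f (z, 0).
Proof. by rewrite /hcoef fact0 invr1 mul1r. Qed.

Lemma theta_coef0 b : theta_coef 0 b z = \sum_j coord_p L j z * (b == lshift n j)%:R.
Proof.
rewrite /theta_coef hcoef0 /Theta big_ord_recl expr0 mul1r big1 ?addr0 => [|i _]; last first.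
  by rewrite expr0n mul0r.
rewrite /theta big_ord_recl big_ord0 addr0.
by apply: eq_bigr => j _; rewrite momentum0 /= Dz_coord.
Qed.

Lemma energy_coef0 : energy_coef 0 z = hamiltonian0 L z.
Proof.
rewrite /energy_coef hcoef0 /Energy big_ord_recl expr0 mul1r big1 ?addr0 => [|i _]; last first.
  by rewrite expr0n mul0r.
rewrite /energy big_ord_recl big_ord0 addr0; congr (_ - _).
  by apply: eq_bigr => j _; rewrite momentum0 mulrC /= mxE.
have [order_eq _] := hjet_lag oQ sL 0; apply: (order_eq 0); last exact: flow_jet_eq1.
exact: (proj2 (flow_jet_smooth 0)).
Qed.

End ZerothOrder.

Lemma smooth_coord_p j : smooth_on U (coord_p L j).
Proof.
have sJ q i : (q <= 1)%N -> smooth_on U (fun z => jet_of1 z q 0 i).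
  by move=> _; exact: smooth_jet_of1.
have QJ z : U z -> Q (jet_of1 z 0%N) by [].
exact: (hjet_comp oU (smooth_on_cst oU 0) sJ QJ (hjet_lag_partial 0 1 j)).
Qed.

Lemma derive_coord_q c j z : 'D_(delta_mx 0 c) (@coord_q R n j) z = (c == lshift n j)%:R.
Proof.
rewrite (_ : @coord_q R n j = fun y => y 0 (lshift n j)).
  by rewrite -(Dz_coord c (lshift n j) (z, 0)) Dz_slice.
by apply/funext => y; rewrite /coord_q mxE.
Qed.

Lemma omega0_entry z c d : omega0 L z c d =
  \sum_j ((c == lshift n j)%:R * 'D_(delta_mx 0 d) (coord_p L j) z -
          (d == lshift n j)%:R * 'D_(delta_mx 0 c) (coord_p L j) z).
Proof.
rewrite /omega0 summxE; apply: eq_bigr => j _.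
by rewrite !mxE !derive_coord_q.
Qed.

Lemma omega_coef0 z : U z -> omega_coef 0 z = omega0 L z.
Proof.
move=> Uz; apply/matrixP => c d; rewrite mxE omega0_entry.
have DT b e : 'D_(delta_mx 0 e) (theta_coef 0 b) z =
    \sum_j (b == lshift n j)%:R * 'D_(delta_mx 0 e) (coord_p L j) z.
  rewrite (derive_ext _ oU (fun y Uy => theta_coef0 Uy b) Uz).
  under [X in 'D__ X z]funext do under eq_bigr do rewrite mulrC.
  have sp j : smooth_on U (fun y => (b == lshift n j)%:R * coord_p L j y).
    exact: (smooth_onM oU (smooth_on_cst oU _) (smooth_coord_p j)).
  rewrite (smooth_derive_sum oU _ Uz)//; apply: eq_bigr => j _.
  by rewrite (smooth_deriveZ oU _ Uz)//; exact: smooth_coord_p.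
have alg (F G : 'I_n -> R) x y : x = \sum_j F j -> y = \sum_j G j ->
    x - y = \sum_j (F j - G j) by move=> -> ->; rewrite sumrB.
exact: alg (DT c d) (DT d c).
Qed.

Lemma derive_coord_p i j z :
  'D_(delta_mx 0 (rshift n j)) (coord_p L i) z = jhessian 1 (lag L 0) (jet_of1 z) j i.
Proof.
rewrite mxE /jpartial derive1E.
have {1}-> : z = z + 0 *: delta_mx 0 (rshift n j) by rewrite scale0r addr0.
apply/esym/derive_slice => t; rewrite /coord_p; congr (jpartial _ _ _ _).
apply/funext => l; case: l => [|[|l]] //=; apply/rowP => k; rewrite !mxE //.
  by rewrite eq_lrshift andbF mulr0 addr0.
by rewrite eq_rshift.
Qed.

(** In the coordinates [(phi, phidot)] the block in [phidot] alone vanishes because [q] does not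
    involve [phidot]; the mixed blocks are the Hessian up to sign and transposition. *)
Lemma omega0_unit z : U z -> omega0 L z \in unitmx.
Proof.
move=> Uz; set W := jhessian 1 (lag L 0) (jet_of1 z).
have uW : W \in unitmx by exact: (hessian_unit rkL).
have alg (x y : R) : false%:R * x - false%:R * y = 0 by rewrite !mul0r subr0.
have o_lr i j : omega0 L z (lshift n i) (rshift n j) = W j i.
  rewrite omega0_entry (bigD1 i isT).
  rewrite [\sum_(_ < _ | _) _]big1 => [|k /andP[_ /negbTE ki]].
    rewrite /= addr0 eqxx mul1r eq_rlshift mul0r subr0.
    exact: derive_coord_p.
  by rewrite eq_lshift eq_rlshift [i == k]eq_sym ki; exact: alg.
have o_rr i j : omega0 L z (rshift n i) (rshift n j) = 0.
  by rewrite omega0_entry big1// => k _; rewrite !eq_rlshift; exact: alg.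
have o_skew c d : omega0 L z d c = - omega0 L z c d.
  by rewrite !omega0_entry -sumrN; apply: eq_bigr => k _; rewrite opprB.
have -> : omega0 L z = block_mx (ulsubmx (omega0 L z)) W^T (- W) 0.
  rewrite -[LHS]submxK; congr block_mx; apply/matrixP => i j.
  - by rewrite [RHS]mxE 2!mxE o_lr.
  - by rewrite [RHS]mxE 2!mxE o_skew o_lr.
  - by rewrite [RHS]mxE 2!mxE o_rr.
set A := ulsubmx _.
(* The explicit right inverse, found by solving for the two block columns; its lower right block
   compensates [A]. *)
have [] // := @mulmx1_unit _ _ (block_mx A W^T (- W) 0)
  (block_mx 0 (- invmx W) (invmx W^T) (invmx W^T *m A *m invmx W)).
rewrite mulmx_block !mulmx0 !mul0mx !addr0 !add0r mulmxV ?unitmx_tr//.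
have -> : A *m - invmx W + W^T *m (invmx W^T *m A *m invmx W) = 0.
  by rewrite mulmxN !mulmxA mulmxV ?unitmx_tr// mul1mx addNr.
have -> : - W *m - invmx W = 1%:M by rewrite mulNmx mulmxN opprK mulmxV.
by rewrite -scalar_mx_block.
Qed.

Lemma hamiltonian_structure_exists :
  exists (w : nat -> Z -> 'M[R]_(n + n)) (H : nat -> Z -> R) (X : R -> Z -> Z),
    [/\ hamiltonian_structure U N w H,
        hamiltonian_field U (hsum N w) (hsum N H) X,
        bigO_h U N.+1 (fun h z => X h z - second_order_field N a h z),
        bigO_h U 1 (fun h z => hsum N w h z - omega0 L z) &
        bigO_h U 1 (fun h z => hsum N H h z - hamiltonian0 L z)].
Proof.
pose w := hsum N omega_coef; pose dH h := differential (hsum N energy_coef h).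
have w0 z : U z -> w 0 z \in unitmx.
  by move=> Uz; rewrite /w hsum0 omega_coef0// omega0_unit.
have unit_near := near_h0_unit oU smooth_hsum_omega w0.
have flat1 (f : Z * R -> R) (g : Z -> R) : smooth_on C f -> smooth_on U g ->
    (forall z, U z -> f (z, 0) = g z) ->
    bigO_h U 1 (fun h z => f (z, h) - g z).
  move=> sf sg fg; have fB : smooth_on C (fun p => f p - g p.1).
    by apply: (smooth_onB oC) => //; exact: smooth_comp_fst.
  apply: (bigO_h_flat oU (f := fun h z => f (z, h) - g z)).
    by apply: smooth_on_ext oC _ fB => -[].
  apply: (hflat_ext oU (f := fun p => f p - g p.1)) => [[]//|].
  by apply/hflatS; split=> // z Uz /=; rewrite fg// subrr.
have on_U (V : normedModType R) (f g : R -> Z -> V) : (forall h z, U z -> f h z = g h z) ->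
    forall z0, U z0 -> \forall z \near z0 & h \near (0 : R), f h z = g h z.
  move=> fg z0 Uz0; exists (U, setT) => /=; last by move=> -[z h] [/= Uz _]; exact: fg.
  by split; [exact: open_nbhs_nbhs|exact: filterT].
(* [X] solves [iota_X w = dH] wherever [w] is invertible; the default value of [invmx] elsewhere is
   avoided by restricting to the neighbourhoods of [unit_near]. *)
exists omega_coef, energy_coef, (fun h z => dH h z *m invmx (w h z)); split.
- split=> [k _|k _|h|].
  + split=> [c d|z Uz]; first exact: smooth_omega_coef.
    by apply/matrixP => c d; rewrite !mxE opprB.
  + exact: smooth_energy_coef.
  + exact: omega_closed.
  + exact: unit_near.
- move=> z0 Uz0; apply: filterS (unit_near z0 Uz0) => -[z h] /= u.
  by rewrite mulmxKV.
(* With [F] the reduced field, [X - F = - (F w - dH) w^-1]: an O(h^(N+1)) defect times a locally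
   bounded inverse. *)
- apply: (@bigO_h_near _ _ _ _ _ (fun h z => - (hamilton_defect h z *m invmx (w h z)))).
    move=> z0 Uz0; apply: filterS (unit_near z0 Uz0) => -[z h] /= u.
    by rewrite /hamilton_defect mulmxBl mulmxK// opprB.
  apply: bigO_h_mx => i j; apply: (@bigO_h_near _ _ _ _ _ (fun h z =>
      \sum_c hamilton_defect h z 0 c * (- 1 * invmx (w h z) c j))).
    apply: on_U => h z _; rewrite (ord1 i) [RHS]mxE mxE -sumrN.
    by apply: eq_bigr => c _; rewrite mulN1r mulrN.
  apply: bigO_h_sum => c; apply: bigO_hM; first exact: hamilton_defect_bigO.
  apply: bigO_hM; last exact: (bigO_h_invmx oU smooth_hsum_omega w0).
  by apply: (bigO_h_flat oU) => //; exact: (smooth_on_cst oC).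
- apply: bigO_h_mx => c d; apply: (@bigO_h_near _ _ _ _ _ (fun h z =>
      hsum N omega_coef h z c d - omega_coef 0 z c d)).
    by apply: on_U => h z Uz; rewrite omega_coef0// [RHS]mxE; congr (_ + _); rewrite [RHS]mxE.
  apply: (flat1 (fun p => hsum N omega_coef p.2 p.1 c d)); first exact: smooth_hsum_omega.
    exact: smooth_omega_coef.
  by move=> z _; rewrite /= hsum0.
- apply: (@bigO_h_near _ _ _ _ _ (fun h z => hsum N energy_coef h z - energy_coef 0 z)).
    by apply: on_U => h z Uz; rewrite energy_coef0.
  apply: (flat1 (fun p => hsum N energy_coef p.2 p.1)); first exact: smooth_hsum_energy.
    exact: smooth_energy_coef.
  by move=> z _; rewrite /= hsum0.
Qed.

End ReducedFlow.

Theorem theorem2p1 (R : realType) (n : nat) (Q : set 'rV[R]_n) (openQ : open Q)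
    (M : nat -> nat) (L : lagrangian R n M) (smoothL : lag_smooth Q L)
    (N : nat) (ND : nondegenerate_lag L Q N) :
  (exists a : nat -> 'rV[R]_(n + n) -> 'rV[R]_n, reduced_coefs L Q N a) /\
  forall a : nat -> 'rV[R]_(n + n) -> 'rV[R]_n, reduced_coefs L Q N a ->
  exists (w : nat -> 'rV[R]_(n + n) -> 'M[R]_(n + n))
         (H : nat -> 'rV[R]_(n + n) -> R)
         (X : R -> 'rV[R]_(n + n) -> 'rV[R]_(n + n)),
    [/\ hamiltonian_structure (Jet1 Q) N w H,
        hamiltonian_field (Jet1 Q) (hsum N w) (hsum N H) X,
        bigO_h (Jet1 Q) N.+1
          (fun h z => X h z - second_order_field N a h z),
        bigO_h (Jet1 Q) 1 (fun h z => hsum N w h z - omega0 L z) &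
        bigO_h (Jet1 Q) 1 (fun h z => hsum N H h z - hamiltonian0 L z)].
Proof.
have rkL (J : jet R n) : Q (J 0%N) -> \rank (jhessian 1 (lag L 0) J) = n.
  move=> QJ; have NDJ := ND J QJ.
  (* The rank of the Hessian of [L^0] does not involve h, so a single small positive h supplies
     it. *)
  by have [h [_ rk]] := @filter_ex _ _ (at_right_proper_filter (0 : R)) _ NDJ.
split; first exact: reduced_coefs_exist.
by move=> a red; exact: (hamiltonian_structure_exists openQ smoothL rkL red).
Qed.
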